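(* For every $n\in\mathbb{N}$ there is a constant $C(n)$ depending only on $n$ such that for every isotropic log-concave probability measure $\mu$ on $\mathbb{R}^n$ with density $\rho$ and isotropic constant $1$, and every vector $h\in\mathbb{R}^n$ with $|h|=1$, one has $\|D_h\mu\|_{\rm TV}\le C(n)$.
   Context: A log-concave probability measure on $\mathbb{R}^n$ is one with density $e^{-V}$ w.r.t. Lebesgue measure on an affine subspace, $V$ convex with values in $(-\infty,+\infty]$. It is isotropic if it is absolutely continuous w.r.t. Lebesgue measure on $\mathbb{R}^n$ and $\int(x,\theta)\mu(dx)=0$, $\int(x,\theta)^2\mu(dx)=L_\mu^2|\theta|^2$ for all $\theta\in\mathbb{R}^n$; $L_\mu$ is the isotropic constant. The Skorohod derivative $D_h\mu$ is the bounded signed Borel measure with $\int\partial_h\varphi\,d\mu=-\int\varphi\,d(D_h\mu)$ for all $\varphi\in C_b^\infty(\mathbb{R}^n)$; $\|D_h\mu\|_{\rm TV}$ is its total variation norm. *)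

(* Defs.v *)
(* R^n is rendered as 'rV[R]_n (row vectors),
   which carries the normed-module structure needed for directional
   derivatives; we equip it with its Borel sigma-algebra below. *)
From HB Require Import structures.
From mathcomp Require Import all_boot all_order all_algebra.
From mathcomp Require Import all_classical all_reals all_analysis.
Set Implicit Arguments. Unset Strict Implicit. Unset Printing Implicit Defensive.
Import Order.TTheory GRing.Theory Num.Theory.
Import numFieldNormedType.Exports.
Local Open Scope classical_set_scope.
Local Open Scope ring_scope.

Definition borel_rV_display : measure_display. Proof. exact. Qed.

Section borel_rV.
Variables (R : realType) (n : nat).

Let borel_set0 : <<s (@open 'rV[R]_n) >> set0.
Proof. exact: sigma_algebra0. Qed.
Let borel_setC (A : set 'rV[R]_n) :
  <<s (@open 'rV[R]_n) >> A -> <<s (@open 'rV[R]_n) >> (~` A).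
Proof. exact: sigma_algebraC. Qed.
Let borel_bigcup (F : (set 'rV[R]_n)^nat) :
  (forall i, <<s (@open 'rV[R]_n) >> (F i)) ->
  <<s (@open 'rV[R]_n) >> (\bigcup_i F i).
Proof. exact: sigma_algebra_bigcup. Qed.

HB.instance Definition _ := @isMeasurable.Build borel_rV_display 'rV[R]_n
  <<s (@open 'rV[R]_n) >> borel_set0 borel_setC borel_bigcup.
End borel_rV.

Section defs.
Variables (R : realType) (n : nat).
Local Notation Rn := 'rV[R]_n.

Definition dotRn (x y : Rn) : R := \sum_(i < n) x ord0 i * y ord0 i.

(* Lebesgue measure on R^n, characterized as the (unique) Borel measure
   giving every half-open box [a,b) its volume prod_i (b_i - a_i). *)
Definition is_lebesgue_Rn (lam : {measure set Rn -> \bar R}) : Prop :=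
  forall a b : Rn, (forall i, a ord0 i <= b ord0 i) ->
    lam [set x : Rn | forall i, a ord0 i <= x ord0 i < b ord0 i]
    = (\prod_(i < n) (b ord0 i - a ord0 i))%:E.

Definition convex_ereal (V : Rn -> \bar R) : Prop :=
  (forall x, V x != -oo%E) /\
  forall (x y : Rn) (t : R), 0 < t < 1 ->
    (V (t *: x + (1 - t) *: y)%R <= t%:E * V x + (1 - t)%:E * V y)%E.

Definition log_concave_density (lam : {measure set Rn -> \bar R})
    (mu : probability Rn R) (rho : Rn -> R) : Prop :=
  measurable_fun setT rho /\
  (exists V : Rn -> \bar R, convex_ereal V /\
     forall x, (rho x)%:E = expeR (- V x)%E) /\
  (forall A, measurable A -> mu A = (\int[lam]_(x in A) (rho x)%:E)%E).

Definition isotropic_with_const (mu : probability Rn R) (L : R) : Prop :=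
  forall theta : Rn,
    (\int[mu]_x ((dotRn x theta)%:E) = 0)%E /\
    (\int[mu]_x ((dotRn x theta ^+ 2)%:E) = (L ^+ 2 * dotRn theta theta)%:E)%E.

Fixpoint iter_dir_deriv (vs : seq Rn) (f : Rn -> R) : Rn -> R :=
  match vs with
  | [::] => f
  | v :: vs' => 'D_v (iter_dir_deriv vs' f)
  end.

Definition Cb_infty (f : Rn -> R) : Prop :=
  (forall (vs : seq Rn) (v x : Rn), derivable (iter_dir_deriv vs f) x v) /\
  (forall vs : seq Rn, exists M : R, forall x, `|iter_dir_deriv vs f x| <= M).

(* ||D_h mu||_TV <= c : the Skorohod derivative D_h mu exists as a bounded
   signed measure nu = nu1 - nu2 (nu1, nu2 finite positive Borel measures),
   i.e.  int d_h phi dmu = - int phi dnu  for all phi in C_b^infty,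
   and its total variation is at most c (the total variation norm of a
   bounded signed measure is the infimum of nu1(R^n) + nu2(R^n) over such
   decompositions, attained by the Jordan decomposition). *)
Definition skorohod_deriv_TV_le (mu : probability Rn R) (h : Rn) (c : R) : Prop :=
  exists nu1 nu2 : {finite_measure set Rn -> \bar R},
    (forall phi : Rn -> R, Cb_infty phi ->
       (\int[mu]_x (('D_h phi x)%:E)
        = - (\int[nu1]_x ((phi x)%:E) - \int[nu2]_x ((phi x)%:E)))%E) /\
    (nu1 setT + nu2 setT <= c%:E)%E.

End defs.

(* Main.v *)
(* On each line in direction h the density is unimodal, so the derivative of
   mu along the line is a difference of two positive measures.  Slicing the
   density by levels s makes them explicit: the superlevel set {rho > s} meets
   the line in an interval, and D_h mu is the image of (line, level) under the
   lower endpoint minus its image under the upper endpoint.  Hence the total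
   variation is at most twice the measure m of the set of pairs (line, s) for
   which the interval is nonempty.

   To bound m, fix x0 with rho x0 close to sup rho.  If {rho >= rho x0 / e} were
   contained in a thin slab around x0, then log-concavity would make rho decay
   quickly off the slab, compared with its values at midpoints with x0, which
   contradicts the unit variance in the direction normal to the slab.  So this
   convex set is wide in every direction and contains a segment of length
   r = r(n) in direction h.  Midpoints of that segment with a point at level
   s <= rho x0 lie at level at least s / sqrt e; integrating over (line, s) gives
   r m <= sqrt e 2^n.

   Lines are parametrized by the points x of the slab 0 <= (x, h) < 1 of R^n,
   which needs only the translation invariance of Lebesgue measure. *)
Require Import Defs.
From HB Require Import structures.
From mathcomp Require Import all_boot all_order all_algebra.
From mathcomp Require Import all_classical all_reals all_analysis.
From mathcomp Require Import perm measurable_realfun ring lra.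
Set Implicit Arguments. Unset Strict Implicit. Unset Printing Implicit Defensive.
Import Order.TTheory GRing.Theory Num.Theory.
Import numFieldNormedType.Exports.
Local Open Scope classical_set_scope.
Local Open Scope ring_scope.

(** * Borel sets of R^n *)

Section borel_rV.
Context {R : realType} {n : nat}.
Notation Rn := 'rV[R]_n.

Definition hbox (a b : Rn) : set Rn :=
  [set x | forall i, a ord0 i <= x ord0 i < b ord0 i].

Lemma le_coord_norm_rV (x : Rn) i : `|x ord0 i| <= `|x|.
Proof.
rewrite [leRHS]/Num.norm/= mx_normrE.
exact: (le_bigmax _ (fun ij => `|x ij.1 ij.2|) (ord0, i)).
Qed.

Lemma countable_bigcup_measurable d (T : measurableType d) (U : countType)
    (D : set U) (F : U -> set T) :
  (forall i, D i -> measurable (F i)) -> measurable (\bigcup_(i in D) F i).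
Proof.
move=> mF; rewrite bigcup_mkcond; apply: countable_bigcupT_measurable => // i.
by case: ifPn => // /set_mem; exact: mF.
Qed.

Lemma open_measurable_rV (U : set Rn) : open U -> measurable U.
Proof. by move=> oU; apply: sub_sigma_algebra. Qed.

Lemma continuous_measurable_rV (f : Rn -> R) :
  continuous f -> measurable_fun setT f.
Proof.
move=> /continuousP cf; apply: (measurability (@RGenOpens.G R)).
- exact: RGenOpens.measurableE.
- move=> _ [_ [a [b ->] <-]]; rewrite setTI.
  by apply: open_measurable_rV; apply: cf; exact: interval_open.
Qed.

Lemma measurable_coord_rV (i : 'I_n) :
  measurable_fun setT (fun x : Rn => x ord0 i).
Proof. by apply: continuous_measurable_rV => x; exact: coord_continuous. Qed.

Lemma measurable_hbox (a b : Rn) : measurable (hbox a b).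
Proof.
have -> : hbox a b = \bigcap_(i in [set: 'I_n])
    ((fun x : Rn => x ord0 i) @^-1` `[a ord0 i, b ord0 i[).
  apply/seteqP; split => x /=.
  - by move=> H i _ /=; rewrite in_itv/=.
  - by move=> H i; have := H i Logic.I; rewrite /= in_itv/=.
apply: fin_bigcap_measurable => // i _.
by rewrite -[X in measurable X]setTI; exact: measurable_coord_rV.
Qed.

(** Half-open boxes with rational corners form a countable family that recovers every open set: the
    norm is the sup norm, so a box whose corners are within [e] of [x] in each coordinate stays in
    the ball. This reduces Borel measurability to boxes. *)
Lemma open_bigcup_hbox (U : set Rn) : open U ->
  U = \bigcup_(q in [set q : 'rV[rat]_n * 'rV[rat]_n |
        hbox (map_mx ratr q.1) (map_mx ratr q.2) `<=` U])
      hbox (map_mx ratr q.1) (map_mx ratr q.2).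
Proof.
move=> oU; apply/seteqP; split => [x Ux|x [q /= qU]]; last exact: qU.
have /nbhs_ballP[e /= e0 eU] : nbhs x U by exact: open_nbhs_nbhs.
have ex_lo i : exists q : rat, x ord0 i - e < ratr q <= x ord0 i.
  have /rat_in_itvoo[q] : x ord0 i - e < x ord0 i by rewrite gtrBl.
  by rewrite in_itv/= => /andP[? /ltW ?]; exists q; apply/andP.
have ex_hi i : exists q : rat, x ord0 i < ratr q < x ord0 i + e.
  have /rat_in_itvoo[q] : x ord0 i < x ord0 i + e by rewrite ltrDl.
  by rewrite in_itv/= => /andP[? ?]; exists q; apply/andP.
have [lo hlo] := choice ex_lo; have [hi hhi] := choice ex_hi.
exists (\row_i lo i, \row_i hi i) => /=; last first.
  move=> i /=; rewrite !mxE; have /andP[_ ->] := hlo i.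
  by have /andP[-> _] := hhi i.
move=> y /= yb; apply: eU; split=> // i j.
rewrite (ord1 i); have := yb j; rewrite !mxE => /andP[y1 y2].
have /andP[l1 l2] := hlo j; have /andP[h1 h2] := hhi j.
by rewrite /ball/= ltr_norml; apply/andP; split; lra.
Qed.

Lemma measurable_fun_rV d (T : measurableType d) (f : T -> Rn) :
  (forall i, measurable_fun setT (fun t => f t ord0 i)) ->
  measurable_fun setT f.
Proof.
move=> mf; apply: (measurability (@open Rn)) => //.
move=> _ [U oU <-]; rewrite setTI.
rewrite (open_bigcup_hbox oU) preimage_bigcup.
apply: countable_bigcup_measurable => //.
move=> q _; have -> : f @^-1` hbox (map_mx ratr q.1) (map_mx ratr q.2) =
   \bigcap_(i in [set: 'I_n]) ((fun t => f t ord0 i) @^-1`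
      `[ratr (q.1 ord0 i), ratr (q.2 ord0 i)[).
  apply/seteqP; split => x /=.
  - by move=> H i _ /=; rewrite in_itv/=; have := H i; rewrite !mxE.
  - by move=> H i; have := H i Logic.I; rewrite /= in_itv/= !mxE.
apply: fin_bigcap_measurable => // i _.
by rewrite -[X in measurable X]setTI; exact: mf.
Qed.

Lemma hbox_generates : @measurable _ Rn = <<s range (fun p => hbox p.1 p.2) >>.
Proof.
apply/seteqP; split => A.
- apply: smallest_sub; first exact: smallest_sigma_algebra.
  move=> U oU; rewrite (open_bigcup_hbox oU).
  pose G := range (fun p : Rn * Rn => hbox p.1 p.2).
  apply: (@countable_bigcup_measurable _ (g_sigma_algebraType G)) => //.
  by move=> q _; apply: sub_sigma_algebra; exists (map_mx ratr q.1, map_mx ratr q.2).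
- apply: smallest_sub; first exact: sigma_algebra_measurable.
  by move=> _ [[a b] _ <-]; exact: measurable_hbox.
Qed.

Lemma hboxI (a b c d : Rn) : hbox a b `&` hbox c d =
  hbox (\row_i Num.max (a ord0 i) (c ord0 i))
       (\row_i Num.min (b ord0 i) (d ord0 i)).
Proof.
apply/seteqP; split => x /=.
- by move=> [h1 h2] i; rewrite !mxE ge_max lt_min; have /andP[-> ->] := h1 i;
    have /andP[-> ->] := h2 i.
- move=> h; split => i; have := h i; rewrite !mxE ge_max lt_min.
    by move=> /andP[/andP[-> _] /andP[-> _]].
  by move=> /andP[/andP[_ ->] /andP[_ ->]].
Qed.

(** Makes [is_lebesgue_Rn], which only speaks of ordered corners, applicable to any box: if some
    [b i < a i], both boxes are empty. *)
Lemma hbox_max (a b : Rn) :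
  hbox a b = hbox a (\row_i Num.max (a ord0 i) (b ord0 i)).
Proof.
apply/seteqP; split => x /= h i; have := h i; rewrite !mxE lt_max.
  by move=> /andP[-> ->]; rewrite orbT.
by move=> /andP[ax]; rewrite ltNge ax.
Qed.

Lemma bigcup_hbox :
  \bigcup_k hbox (const_mx (- k%:R)) (const_mx k%:R) = [set: Rn].
Proof.
apply/seteqP; split => // x _; exists (Num.truncn `|x|).+1 => //= i; rewrite !mxE.
have : `|x ord0 i| < (Num.truncn `|x|).+1%:R.
  by apply: le_lt_trans (truncnS_gt _); exact: le_coord_norm_rV.
by rewrite ltr_norml => /andP[/ltW -> ->].
Qed.

(** Boxes are stable under intersection, generate the Borel sets, and exhaust the space by sets of
    finite measure, so the uniqueness theorem for measures applies. *)
Lemma measure_eq_hbox (m1 m2 : {measure set Rn -> \bar R}) :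
  (forall a b : Rn, (forall i, a ord0 i <= b ord0 i) ->
     m1 (hbox a b) = m2 (hbox a b)) ->
  (forall a b : Rn, (m1 (hbox a b) < +oo)%E) ->
  forall A, measurable A -> m1 A = m2 A.
Proof.
move=> m12 m1fin.
pose g k : set Rn := hbox (const_mx (- k%:R)) (const_mx k%:R).
apply: (measure_unique (range (fun p => hbox p.1 p.2)) g).
- exact: hbox_generates.
- move=> _ _ [[a b] _ <-] [[c d] _ <-]; rewrite hboxI.
  by exists (\row_i Num.max (a ord0 i) (c ord0 i),
       \row_i Num.min (b ord0 i) (d ord0 i)).
- by move=> k; exists (const_mx (- k%:R), const_mx k%:R).
- exact: bigcup_hbox.
- move=> _ [[a b] _ <-] /=; rewrite hbox_max; apply: m12 => i.
  by rewrite mxE le_max lexx.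
- by move=> k; exact: m1fin.
Qed.

End borel_rV.

(** * Lebesgue measure on R^n *)

(** Equips the bare measure [lam] of the theorem with the structure that Fubini-Tonelli asks for,
    without changing the set function. *)
Lemma sigma_finite_measureP d (T : measurableType d) (R : realType)
    (m : {measure set T -> \bar R}) : sigma_finite setT m ->
  exists m' : {sigma_finite_measure set T -> \bar R}, (m' : set T -> \bar R) = m.
Proof.
move=> h; pose m' : {sigma_finite_measure set T -> \bar R} :=
  HB.pack_for (SigmaFiniteMeasure.type T R) (Measure.sort m)
  (isSFinite.Build _ _ _ (Measure.sort m) (sfinite_measure_sigma_finite h))
  (isSigmaFinite.Build _ _ _ (Measure.sort m) h).
by exists m'.
Qed.

(** * The Euclidean inner product *)

Section dot.
Context {R : realType} {n : nat}.
Notation Rn := 'rV[R]_n.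
Implicit Types x y z : Rn.

Lemma dotRnC x y : dotRn x y = dotRn y x.
Proof. by apply: eq_bigr => i _; rewrite mulrC. Qed.

Lemma dotRnDl x y z : dotRn (x + y) z = dotRn x z + dotRn y z.
Proof. by rewrite -big_split; apply: eq_bigr => i _; rewrite mxE mulrDl. Qed.

Lemma dotRnZl c x y : dotRn (c *: x) y = c * dotRn x y.
Proof. by rewrite big_distrr; apply: eq_bigr => i _; rewrite mxE /= mulrA. Qed.

Lemma dotRnBl x y z : dotRn (x - y) z = dotRn x z - dotRn y z.
Proof. by rewrite -scaleN1r dotRnDl dotRnZl mulN1r. Qed.

Lemma dotRn_ge0 x : 0 <= dotRn x x.
Proof. by apply: sumr_ge0 => i _; exact: sqr_ge0. Qed.

Lemma dotRn_eq0 x : dotRn x x = 0 -> x = 0.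
Proof.
move=> /eqP; rewrite psumr_eq0; last by move=> i _; exact: sqr_ge0.
move=> /allP h; apply/rowP => i; rewrite mxE.
by have := h i (mem_index_enum _); rewrite mulf_eq0 orbb => /eqP.
Qed.

Lemma dotRn_CS x y : dotRn x y ^+ 2 <= dotRn x x * dotRn y y.
Proof.
have [/dotRn_eq0 ->|y0] := eqVneq (dotRn y y) 0.
  have z u : dotRn u (0 : Rn) = 0 by apply: big1 => i _; rewrite mxE mulr0.
  by rewrite !z mulr0 expr0n.
have yp : 0 < dotRn y y by rewrite lt_neqAle eq_sym y0 dotRn_ge0.
set c := dotRn x y; set b := dotRn y y.
have := dotRn_ge0 (b *: x - c *: y).
have -> : dotRn (b *: x - c *: y) (b *: x - c *: y) =
    b * (b * dotRn x x - c ^+ 2).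
  rewrite dotRnBl !(dotRnZl,dotRnC _ (_ - _)) !dotRnBl !dotRnZl.
  by rewrite -/b (dotRnC y x) -/c; ring.
by rewrite pmulr_rge0// subr_ge0 mulrC.
Qed.

Lemma measurable_dotRn y : measurable_fun setT (fun x => dotRn x y).
Proof.
apply: measurable_sum => i; apply: measurable_funM => //.
exact: measurable_coord_rV.
Qed.

End dot.

(** * Lebesgue measure under homotheties and translations *)

Section lebesgue_rV.
Context {R : realType} {n : nat}.
Notation Rn := 'rV[R]_n.
Context {lam : {measure set Rn -> \bar R}} (Hlam : is_lebesgue_Rn lam).

Lemma lebesgue_hbox_lty (a b : Rn) : (lam (hbox a b) < +oo)%E.
Proof.
rewrite hbox_max Hlam ?ltry// => i.
by rewrite mxE le_max lexx.
Qed.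

Lemma lebesgue_rV_sigma_finite : sigma_finite setT lam.
Proof.
exists (fun k => hbox (const_mx (- k%:R)) (const_mx k%:R)).
  by apply/esym; exact: bigcup_hbox.
by move=> k; split; [exact: measurable_hbox|exact: lebesgue_hbox_lty].
Qed.

Lemma measurable_affine_rV (c : R) (v : Rn) :
  measurable_fun setT (fun x : Rn => c *: x + v).
Proof.
apply: measurable_fun_rV => i; under eq_fun do rewrite !mxE.
by apply: measurable_funD => //; apply: measurable_funM => //;
  exact: measurable_coord_rV.
Qed.

Lemma measurable_line_rV (h : Rn) :
  measurable_fun setT (fun z : Rn * R => z.1 + z.2 *: h).
Proof.
apply: measurable_fun_rV => i; under eq_fun do rewrite !mxE.
apply: measurable_funD.
  by apply: (measurableT_comp (@measurable_coord_rV R n i)).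
by apply: measurable_funM.
Qed.

(** Both sides are measures in [A], so boxes suffice; the preimage of a box is a box whose [n] sides
    are each divided by [c]. *)
Lemma lebesgue_affine (c : R) (v : Rn) (A : set Rn) : 0 < c -> measurable A ->
  lam ((fun x => c *: x + v) @^-1` A) = ((c ^- n)%:E * lam A)%E.
Proof.
move=> c0 mA.
have cn0 : 0 <= c ^- n by rewrite invr_ge0 exprn_ge0// ltW.
have mT := measurable_affine_rV c v.
pose m1 : {measure set Rn -> \bar R} :=
  measure_function_pushforward__canonical__measure_function_Measure lam mT.
pose m2 : {measure set Rn -> \bar R} := mscale (NngNum cn0) lam.
have pre a b : (fun x => c *: x + v) @^-1` hbox a b =
    hbox (c^-1 *: (a - v)) (c^-1 *: (b - v)).
  apply/seteqP; split => x /= hx i; have := hx i; rewrite !mxE;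
  by rewrite -lerBlDr -ltrBrDr ler_pdivrMl// ltr_pdivlMl.
have m1E a b : m1 (hbox a b) = lam (hbox (c^-1 *: (a - v)) (c^-1 *: (b - v))).
  by rewrite -pre.
apply: (@measure_eq_hbox _ _ m1 m2 _ _ A mA) => a b; last first.
  by rewrite m1E lebesgue_hbox_lty.
move=> ab; rewrite m1E Hlam; last first.
  by move=> i; rewrite !mxE ler_pM2l ?invr_gt0// lerB.
rewrite [RHS]/= /mscale/= Hlam// -EFinM; congr EFin.
rewrite -exprVn -[X in _ ^+ X](card_ord n) -prodr_const -big_split/=.
by apply: eq_bigr => i _; rewrite !mxE -mulrBr; congr (_ * _); ring.
Qed.

Lemma ge0_integral_affine (c : R) (v : Rn) (f : Rn -> \bar R) : 0 < c ->
  measurable_fun setT f -> (forall x, 0 <= f x)%E ->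
  (\int[lam]_x f (c *: x + v)%R = (c ^- n)%:E * \int[lam]_x f x)%E.
Proof.
move=> c0 mf f0.
have cn0 : 0 <= c ^- n by rewrite invr_ge0 exprn_ge0// ltW.
have mT := measurable_affine_rV c v.
rewrite -(ge0_integral_mscale lam measurableT (NngNum cn0) mf)//.
transitivity (\int[pushforward lam (fun x : Rn => c *: x + v)%R]_x f x)%E.
  by rewrite (ge0_integral_pushforward mT)// => x _; exact: f0.
pose m1 : {measure set Rn -> \bar R} :=
  measure_function_pushforward__canonical__measure_function_Measure lam mT.
apply: (eq_measure_integral (mscale (NngNum cn0) lam) (m1 := m1)) => A mA _.
exact: lebesgue_affine.
Qed.

End lebesgue_rV.

(** * Integration along lines *)

Section lines.
Context {R : realType} {n : nat}.
Notation Rn := 'rV[R]_n.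
Notation leb := (@lebesgue_measure R).
Context (lam : {sigma_finite_measure set Rn -> \bar R}) (Hlam : is_lebesgue_Rn lam).
Context (h : Rn) (hh : dotRn h h = 1).

Definition slab : set Rn := [set x | 0 <= dotRn x h < 1].

Lemma measurable_slab : measurable slab.
Proof.
rewrite (_ : slab = (fun x => dotRn x h) @^-1` `[0, 1[).
  by rewrite -[X in measurable X]setTI; exact: measurable_dotRn.
by apply/seteqP; split => x /=; rewrite in_itv.
Qed.

(** Since [h] is a unit vector, the admissible [t] fill an interval of length one. Hence
    parametrizing lines by slab points counts every point of the space with total weight one. *)
Lemma integral_slab_line (x : Rn) :
  (\int[leb]_t (\1_slab (x - t *: h))%:E = 1)%E.
Proof.
transitivity (\int[leb]_t (\1_`]dotRn x h - 1, dotRn x h] t)%:E)%E.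
  apply: eq_integral => t _; rewrite !indicE; congr (_%:R%:E); congr nat_of_bool.
  apply/idP/idP; rewrite !inE /slab /= in_itv/= dotRnBl dotRnZl hh mulr1;
  move=> /andP[? ?]; apply/andP; split; lra.
rewrite integral_indic//= setIT lebesgue_measure_itv/= lte_fin gtrBl ltr01.
by rewrite -EFinB; congr EFin; ring.
Qed.

Lemma ge0_integral_lines (g : Rn -> \bar R) :
  measurable_fun setT g -> (forall x, 0 <= g x)%E ->
  (\int[lam]_x g x = \int[lam]_(x in slab) \int[leb]_t g (x + t *: h)%R)%E.
Proof.
move=> mg g0.
have mline : measurable_fun setT (fun z : Rn * R => g (z.1 + z.2 *: h)).
  by apply: (measurableT_comp mg); exact: measurable_line_rV.
have mg1 : measurable_fun setT (fun z : Rn * R => g z.1).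
  exact: (measurableT_comp mg).
have mslab : measurable_fun setT (fun x : Rn => (\1_slab x)%:E : \bar R).
  by apply/measurable_EFinP; apply: measurable_indic; exact: measurable_slab.
have mline' : measurable_fun setT (fun z : Rn * R => z.1 - z.2 *: h).
  have := @measurable_line_rV R n (- h); congr measurable_fun.
  by apply/funext => z; rewrite scalerN.
apply/esym.
transitivity (\int[lam]_x \int[leb]_t (g (x + t *: h)%R * (\1_slab x)%:E))%E.
  rewrite integral_mkcond; apply: eq_integral => x _.
  rewrite patchE indicE; case: ifPn => _.
    by apply: eq_integral => t _; rewrite mule1.
  by under eq_integral do rewrite mule0; rewrite integral0.
rewrite (@fubini_tonelli _ _ _ _ R lam leb
  (fun z => g (z.1 + z.2 *: h)%R * (\1_slab z.1)%:E)%E)/=; last 2 first.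
- by apply: emeasurable_funM => //; exact: (measurableT_comp mslab).
- by move=> z; rewrite mule_ge0// lee_fin.
(* For fixed [t], translating by [t *: h] frees [g] of [t] and moves the slab instead. *)
transitivity (\int[leb]_t \int[lam]_x (g x * (\1_slab (x - t *: h)%R)%:E))%E.
  apply: eq_integral => t _.
  pose G (x : Rn) := (g x * (\1_slab (x - t *: h)%R)%:E)%E.
  transitivity (\int[lam]_x G (1 *: x + t *: h)%R)%E.
    by apply: eq_integral => x _; rewrite /G scale1r addrK.
  rewrite (ge0_integral_affine Hlam)// ?expr1n ?invr1 ?mul1e//.
  - apply: emeasurable_funM => //; apply: (measurableT_comp mslab).
    have := @measurable_affine_rV R n 1 (- (t *: h)); congr measurable_fun.
    by apply/funext => z; rewrite scale1r.
  - by move=> x; rewrite mule_ge0// lee_fin.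
(* Swapping back leaves, for each [x], the integral over [t] of the moved indicator, which is
   one. *)
rewrite -(@fubini_tonelli _ _ _ _ R lam leb
  (fun z => g z.1 * (\1_slab (z.1 - z.2 *: h)%R)%:E)%E)/=; last 2 first.
- by apply: emeasurable_funM => //; exact: (measurableT_comp mslab).
- by move=> z; rewrite mule_ge0// lee_fin.
apply: eq_integral => x _; rewrite ge0_integralZl//.
- by rewrite integral_slab_line mule1.
- apply: (measurableT_comp mslab).
  exact: (measurableT_comp mline' (@pair1_measurable _ _ _ _ x)).
Qed.

Lemma measurable_layer d (T : measurableType d) (p u v : T -> R) :
  measurable_fun setT p -> measurable_fun setT u -> measurable_fun setT v ->
  measurable_fun setT (fun z => p z * \1_`]0, u z[ (v z)).
Proof.
move=> mp mu mv; apply: measurable_funM => //.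
rewrite (_ : (fun z => _) = \1_[set z | 0 < v z < u z]); last first.
  apply/funext => z; rewrite !indicE.
  suff -> : (v z \in `]0, u z[%classic) = (z \in [set z | 0 < v z < u z]) by [].
  by apply/idP/idP; rewrite !inE/= ?in_itv.
apply: measurable_indic.
rewrite (_ : [set z | _] = (fun z => (0 < v z) && (v z < u z)) @^-1` [set true]).
  rewrite -[X in measurable X]setTI.
  have mb : measurable_fun setT (fun z => (0 < v z) && (v z < u z)).
    by apply: measurable_and; exact: measurable_fun_ltr.
  exact: mb.
by apply/seteqP; split.
Qed.

Lemma integral_layer (a b : R) : 0 <= a -> 0 <= b ->
  (\int[leb]_s (a * \1_`]0, b[ s)%:E = (a * b)%:E)%E.
Proof.
move=> a0 b0; under eq_integral do rewrite EFinM.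
rewrite ge0_integralZl//; last first.
  by apply/measurable_EFinP; exact: measurable_indic.
rewrite integral_indic//= setIT lebesgue_measure_itv/= lte_fin.
case: ltP => b1; first by rewrite sube0 -EFinM.
by rewrite mule0 (le_anti (introT andP (conj b1 b0))) mulr0.
Qed.

Lemma measurable_layer_line (psi f : Rn -> R) :
  measurable_fun setT psi -> measurable_fun setT f ->
  measurable_fun setT (fun z : (Rn * R) * R =>
    psi (z.1.1 + z.2 *: h) * \1_`]0, f (z.1.1 + z.2 *: h)[ z.1.2).
Proof.
move=> mpsi mf.
have ml : measurable_fun setT (fun z : (Rn * R) * R => z.1.1 + z.2 *: h).
  apply: (@measurableT_comp _ _ _ _ _ _ _ _ (fun z : (Rn * R) * R => (z.1.1, z.2))
    (@measurable_line_rV R n h)).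
  by apply: measurable_fun_pair => //; exact: (measurableT_comp measurable_fst).
apply: measurable_layer; [exact: (measurableT_comp mpsi)|exact: (measurableT_comp mf)|].
exact: (measurableT_comp measurable_snd).
Qed.

(** The integral of [psi] over the part of the line through [z.1] where [f] exceeds the level [z.2],
    with levels at or below zero contributing nothing. For [psi = 1] it is the length of the
    chord. *)
Definition line_layer (psi f : Rn -> R) (z : Rn * R) : \bar R :=
  (\int[leb]_t (psi (z.1 + t *: h) * \1_`]0, f (z.1 + t *: h)[ z.2)%:E)%E.

Lemma line_layer_ge0 (psi f : Rn -> R) z :
  (forall x, 0 <= psi x) -> (0 <= line_layer psi f z)%E.
Proof.
by move=> psi0; apply: integral_ge0 => t _; rewrite lee_fin mulr_ge0.
Qed.

Lemma measurable_line_layer (psi f : Rn -> R) :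
  measurable_fun setT psi -> measurable_fun setT f ->
  (forall x, 0 <= psi x) -> measurable_fun setT (line_layer psi f).
Proof.
move=> mpsi mf psi0.
apply: (@measurable_fun_fubini_tonelli_F _ _ _ _ _ leb (fun z : (Rn * R) * R =>
    (psi (z.1.1 + z.2 *: h) * \1_`]0, f (z.1.1 + z.2 *: h)[ z.1.2)%:E)).
- by apply/measurable_EFinP; exact: measurable_layer_line.
- by move=> z; rewrite lee_fin mulr_ge0.
Qed.

(* Layer-cake along each line: [f = \int_s 1_{s < f}], then swap [s] and [t]. *)
Lemma ge0_integral_line_layer (psi f : Rn -> R) :
  measurable_fun setT psi -> measurable_fun setT f ->
  (forall x, 0 <= psi x) -> (forall x, 0 <= f x) ->
  (\int[lam]_x (psi x * f x)%:E =
   \int[lam \x leb]_(z in slab `*` setT) line_layer psi f z)%E.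
Proof.
move=> mpsi mf psi0 f0.
have mL := measurable_line_layer mpsi mf psi0.
have mS : measurable (slab `*` [set: R]).
  by apply: measurableX => //; exact: measurable_slab.
rewrite ge0_integral_lines; last 2 first.
- by apply/measurable_EFinP; exact: measurable_funM.
- by move=> x; rewrite lee_fin mulr_ge0.
rewrite [RHS]integral_mkcond fubini_tonelli1; last 2 first.
- by apply/(measurable_restrictT _ _).1 => //; exact: measurable_funS mL.
- by move=> z; rewrite patchE; case: ifP => // _; exact: line_layer_ge0.
rewrite [LHS]integral_mkcond; apply: eq_integral => x _.
rewrite /fubini_F patchE; have [xW|xW] := boolP (x \in slab); last first.
  rewrite integral0_eq// => s _; rewrite patchE ifF//.
  by apply: contraNF xW; rewrite !inE => -[].
transitivity (\int[leb]_s line_layer psi f (x, s))%E; last first.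
  apply: eq_integral => s _; rewrite patchE ifT//.
  by move: xW; rewrite !inE => xW; split.
rewrite /line_layer /=.
rewrite (@fubini_tonelli _ _ _ _ R leb leb
  (fun z => (psi (x + z.2 *: h) * \1_`]0, f (x + z.2 *: h)[ z.1)%:E))/=; last 2 first.
- apply/measurable_EFinP.
  apply: (@measurableT_comp _ _ _ _ _ _ _ _ (fun z : R * R => ((x, z.1), z.2))
    (measurable_layer_line mpsi mf)).
  by apply: measurable_fun_pair => //; exact: measurable_fun_pair.
- by move=> z; rewrite lee_fin mulr_ge0.
by apply: eq_integral => t _; rewrite integral_layer.
Qed.

End lines.

(** * Chords of fat convex sets *)

Section fat_convex_set.
Context {R : realType} {n : nat}.
Notation Rn := 'rV[R]_n.
Context (D : set Rn) (w B : R).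
Hypothesis D0 : D 0.
Hypothesis Dconv : forall x y t, 0 <= t <= 1 -> D x -> D y ->
  D (t *: x + (1 - t) *: y).
Hypothesis Dbounded : forall d i, D d -> `|d ord0 i| <= B.
Hypothesis Dfat : forall theta, theta != 0 ->
  exists2 d, D d & w ^+ 2 * dotRn theta theta < dotRn d theta ^+ 2.

Lemma dotRn_mulmx (x y : Rn) : (x *m y^T) ord0 ord0 = dotRn x y.
Proof. by rewrite mxE; apply: eq_bigr => i _; rewrite mxE. Qed.

(** Fewer than [n] rows leave a nonzero [v] orthogonal to all of them; fatness in direction [v]
    supplies a point of [D] not orthogonal to [v], hence outside their span. *)
Lemma fat_row_free k : (k <= n)%N ->
  exists A : 'M[R]_(k, n), (forall i, D (row i A)) /\ row_free A.
Proof.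
elim: k => [_|k IH kn].
  by exists 0; split => [[]//|]; rewrite /row_free mxrank0.
have [A [AD Afree]] := IH (ltnW kn).
have : kermx A^T != 0.
  rewrite kermx_eq0 /row_free neq_ltn mxrank_tr.
  by rewrite (leq_ltn_trans (rank_leq_row A) kn).
move=> /rowV0Pn[v /sub_kermxP vA v0].
have [d Dd dv] := Dfat v0.
rewrite -addn1; exists (col_mx A d); split.
  move=> i; case: (split_ordP i) => j ->; first by rewrite rowKu.
  by rewrite rowKd row_id.
have dA : ~~ (d <= A)%MS.
  apply/negP => /submxP[u dE]; move: dv; rewrite -(dotRn_mulmx d v) dE.
  have -> : u *m A *m v^T = 0.
    by rewrite -mulmxA -[A]trmxK -trmx_mul vA trmx0 mulmx0.
  by rewrite mxE expr0n/= ltNge mulr_ge0// ?sqr_ge0// dotRn_ge0.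
have AAd : (A < A + d)%MS.
  by rewrite ltmxE addsmxSl/= addsmx_sub submx_refl.
rewrite /row_free eqn_leq rank_leq_row/= -addsmxE addn1.
by have := rank_ltmx AAd; rewrite (eqP Afree).
Qed.

Lemma fat_det_neq0 :
  exists A : 'M[R]_n, (forall i, D (row i A)) /\ \det A != 0.
Proof.
have [A [AD Afree]] := fat_row_free (leqnn n).
by exists A; split => //; rewrite -unitfE -unitmxE -row_free_unit.
Qed.

(** [D] need not be closed, so a maximal determinant may not exist; a matrix beyond half of the
    supremum is enough. The supremum is finite by the Leibniz expansion and positive by
    [fat_det_neq0]. *)
Lemma fat_det_quasimax : exists A : 'M[R]_n,
  [/\ forall i, D (row i A), \det A != 0 &
   forall A', (forall i, D (row i A')) -> `|\det A'| <= 2 * `|\det A|].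
Proof.
pose S := [set x : R | exists2 A : 'M[R]_n, (forall i, D (row i A)) & x = `|\det A|].
have Sub : has_ubound S.
  exists (\sum_(s : {perm 'I_n}) B ^+ n) => _ [A AD ->].
  rewrite /determinant; apply: le_trans (ler_norm_sum _ _ _) _.
  apply: ler_sum => s _; rewrite normrM normr_sign mul1r normr_prod.
  rewrite (_ : B ^+ n = \prod_(i < n) B); last by rewrite prodr_const card_ord.
  apply: ler_prod => i _.
  by rewrite normr_ge0/= (le_trans _ (Dbounded (s i) (AD i)))// mxE.
have [A0 [A0D A0det]] := fat_det_neq0.
have S0 : S !=set0 by exists `|\det A0|; exists A0.
have supS : 0 < sup S.
  apply: (@lt_le_trans _ _ `|\det A0|); first by rewrite normr_gt0.
  by apply: ub_le_sup => //; exists A0.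
have [_ [A AD ->] Alt] : exists2 y, S y & sup S / 2 < y.
  by apply: sup_gt => //; lra.
exists A; split => //.
  by rewrite -normr_gt0; apply: lt_trans Alt; lra.
move=> A' A'D; apply: (@le_trans _ _ (sup S)); last lra.
by apply: ub_le_sup => //; exists A'.
Qed.

(** Weights may sum to less than one because the missing weight can be put on the origin, a point of
    [D]. *)
Lemma convex_comb_mem (I : finType) (c : I -> R) (v : I -> Rn) :
  (forall i, 0 <= c i) -> \sum_i c i <= 1 -> (forall i, D (v i)) ->
  D (\sum_i c i *: v i).
Proof.
move=> c0 c1 vD.
(* Invariant of partial sums: a point of [D] scaled by the weight collected so far. Unnormalized
   weights avoid dividing until two positive totals are merged. *)
pose K (x : Rn) (a : R) := 0 <= a /\ exists2 d, D d & x = a *: d.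
have [sum0 [d Dd ->]] : K (\sum_i c i *: v i) (\sum_i c i).
  apply: (big_ind2 K); [| |by move=> i _; split => //; exists (v i)].
    by split => //; exists 0 => //; rewrite scaler0.
  move=> _ a1 _ a2 [a10 [d1 Dd1 ->]] [a20 [d2 Dd2 ->]]; split.
    exact: addr_ge0.
  have [a12|a12] := eqVneq (a1 + a2) 0.
    have [-> ->] : a1 = 0 /\ a2 = 0 by split; lra.
    by exists 0 => //; rewrite !scale0r scaler0 addr0.
  have ap : 0 < a1 + a2 by rewrite lt_neqAle eq_sym a12 addr_ge0.
  exists (a1 / (a1 + a2) *: d1 + (1 - a1 / (a1 + a2)) *: d2).
    apply: Dconv => //; rewrite divr_ge0 ?addr_ge0//=.
    by rewrite ler_pdivrMr// mul1r lerDl.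
  rewrite scalerDr !scalerA; congr (_ *: _ + _ *: _); field; exact: a12.
set s := \sum_i c i in c1 sum0 *.
have -> : s *: d = s *: d + (1 - s) *: 0 by rewrite scaler0 addr0.
by apply: Dconv => //; rewrite sum0.
Qed.

(** Cramer's rule, by Laplace expansion along row [j], whose cofactors do not see that row. *)
Lemma det_replace_row (A : 'M[R]_n) (d : Rn) (j : 'I_n) :
  \det (\matrix_(i, k) if i == j then d ord0 k else A i k) =
  (d *m \adj A) ord0 j.
Proof.
rewrite (expand_det_row _ j) mxE; apply: eq_bigr => k _.
rewrite !mxE eqxx; congr (_ * (_ * \det _)).
by apply/matrixP => a b; rewrite !mxE eq_sym (negbTE (neq_lift _ _)).
Qed.

(* For rows of [A] in [D] with [|det A|] nearly maximal, the dual basis is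
   bounded on [D], hence short because [D] is fat; so [h] has small
   coordinates in the basis of rows, and splitting their signs writes a
   multiple of [h] as a difference of two points of [D]. *)
Lemma fat_chord (h : Rn) : dotRn h h = 1 ->
  exists d1 d2, [/\ D d1, D d2 & d1 - d2 = (w / (2 * n.+1%:R)) *: h].
Proof.
move=> hh; have [A [AD Adet Amax]] := fat_det_quasimax.
set dA := \det A in Adet Amax.
(* The vectors [theta j] are [\det A] times the basis dual to the rows of [A]. *)
pose theta j : Rn := (col j (\adj A))^T.
have dtheta d j : dotRn d (theta j) = (d *m \adj A) ord0 j.
  by rewrite mxE; apply: eq_bigr => i _; rewrite !mxE.
(* Putting [d] in row [j] keeps all rows in [D], so quasi-maximality bounds the new determinant by
   twice the old one. *)
have theta_bnd d j : D d -> dotRn d (theta j) ^+ 2 <= 4 * dA ^+ 2.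
  move=> Dd; rewrite dtheta -det_replace_row.
  set M := \matrix_(_, _) _.
  suff : `|\det M| <= 2 * `|dA|.
    rewrite -ler_sqr ?nnegrE ?mulr_ge0 ?normr_ge0// exprMn.
    rewrite (real_normK (num_real (\det M))) (real_normK (num_real dA)).
    by move/le_trans; apply; rewrite -natrX.
  apply: Amax => i.
  have [->|ij] := eqVneq i j.
    rewrite (_ : row _ _ = d)//; apply/rowP => k.
    by rewrite !mxE eqxx.
  rewrite (_ : row _ _ = row i A)//; apply/rowP => k.
  by rewrite !mxE (negbTE ij).
have theta_small j : w ^+ 2 * dotRn (theta j) (theta j) <= 4 * dA ^+ 2.
  have [->|/Dfat[d Dd dt]] := eqVneq (theta j) 0.
    rewrite [dotRn _ _]big1 => [|i _]; last by rewrite mxE mulr0.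
    by rewrite mulr0; apply: mulr_ge0 => //; exact: sqr_ge0.
  exact: le_trans (ltW dt) (theta_bnd _ _ Dd).
(* The coordinates of [h] in the basis of rows; Cauchy-Schwarz and [theta_small] bound them. *)
pose a j := dotRn h (theta j) / dA.
have wa j : `|w * a j| <= 2.
  rewrite -ler_sqr ?nnegrE// real_normK ?num_real//.
  have dA2 : 0 < dA ^+ 2 by rewrite exprn_even_gt0.
  rewrite -(ler_pM2r dA2).
  have -> : (w * a j) ^+ 2 * dA ^+ 2 = w ^+ 2 * dotRn h (theta j) ^+ 2.
    by rewrite /a; field.
  apply: le_trans (_ : w ^+ 2 * dotRn (theta j) (theta j) <= _).
    rewrite ler_wpM2l ?sqr_ge0//.
    by have := dotRn_CS h (theta j); rewrite hh mul1r.
  by apply: le_trans (theta_small j) _; rewrite -natrX lexx.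
have hE : h = \sum_j a j *: row j A.
  have : h *m \adj A *m A = dA *: h by rewrite -mulmxA mul_adj_mx mul_mx_scalar.
  rewrite mulmx_sum_row => /(congr1 (fun x => dA^-1 *: x)).
  rewrite scalerA mulVf// scale1r => <-; rewrite scaler_sumr.
  by apply: eq_bigr => j _; rewrite scalerA -dtheta /a mulrC.
(* The factor [2 * n.+1] turns the bound 2 on [w * a j] into [1 / n.+1], so that the [n] positive
   parts, and likewise the negative parts, are weights with sum at most one. *)
set r := w / _; pose c j := r * a j.
have cle j : `|c j| <= n.+1%:R^-1.
  have -> : c j = (w * a j) / (2 * n.+1%:R).
    by rewrite /c /r mulrAC.
  rewrite normrM (ger0_norm (x := _^-1)) ?invr_ge0 ?mulr_ge0//.
  by rewrite invfM mulrA -[leRHS]mul1r ler_wpM2r ?invr_ge0// ler_pdivrMr// mul1r wa.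
have sum_le (e : 'I_n -> R) : (forall j, e j <= n.+1%:R^-1) -> \sum_j e j <= 1.
  move=> ele; apply: (@le_trans _ _ (\sum_(j < n) n.+1%:R^-1)); first exact: ler_sum.
  rewrite sumr_const card_ord -[_ *+ n]mulr_natl ler_pdivrMr ?ltr0n// mul1r.
  by rewrite ler_nat.
exists (\sum_j Num.max (c j) 0 *: row j A), (\sum_j Num.max (- c j) 0 *: row j A).
split.
- apply: convex_comb_mem => //; first by move=> i; rewrite le_max lexx orbT.
  apply: sum_le => j; rewrite ge_max invr_ge0 ler0n andbT.
  exact: le_trans (ler_norm _) (cle j).
- apply: convex_comb_mem => //; first by move=> i; rewrite le_max lexx orbT.
  apply: sum_le => j; rewrite ge_max invr_ge0 ler0n andbT.
  by apply: le_trans (ler_norm _) _; rewrite normrN.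
- rewrite [in RHS]hE scaler_sumr -sumrB; apply: eq_bigr => j _.
  rewrite -scalerBl scalerA -/(c j); congr (_ *: _).
  by case: (leP (c j) 0) => cj; case: (leP (- c j) 0) => cj'; lra.
Qed.

End fat_convex_set.

(** * Densities and log-concave functions *)

Section density.
Context d (T : measurableType d) (R : realType).
Context (m mu : {measure set T -> \bar R}) (g : T -> R).
Hypothesis mg : measurable_fun setT g.
Hypothesis g0 : forall x, 0 <= g x.
Hypothesis muE : forall A, measurable A -> mu A = (\int[m]_(x in A) (g x)%:E)%E.
Local Open Scope ereal_scope.

Let integral_density_indic (A : set T) : measurable A ->
  \int[mu]_x (\1_A x)%:E = \int[m]_x ((\1_A x)%:E * (g x)%:E).
Proof.
move=> mA; rewrite integral_indic// setIT muE// integral_mkcond.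
apply: eq_integral => x _; rewrite patchE indicE.
by case: ifPn => _; rewrite ?mul1e ?mul0e.
Qed.

Import HBNNSimple.

Let integral_density_nnsfun (f : {nnsfun T >-> R}) :
  \int[mu]_x (f x)%:E = \int[m]_x ((f x)%:E * (g x)%:E).
Proof.
under [LHS]eq_integral do rewrite fimfunE -fsumEFin//.
rewrite [LHS]ge0_integral_fsum//; last 2 first.
  - by move=> r; exact/measurable_EFinP/measurableT_comp.
  - by move=> r x _; rewrite EFinM nnfun_muleindic_ge0.
under [RHS]eq_integral.
  move=> x xD; rewrite fimfunE -fsumEFin// ge0_mule_fsuml; last first.
    by move=> r; rewrite EFinM nnfun_muleindic_ge0.
  over.
rewrite [RHS]ge0_integral_fsum//; last 2 first.
  - move=> r; apply: emeasurable_funM; apply/measurable_EFinP => //.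
    exact: measurableT_comp.
  - by move=> r x _; rewrite EFinM mule_ge0// ?nnfun_muleindic_ge0 ?lee_fin.
apply: eq_fsbigr => c rf.
have c0 : (0 <= c)%R by move/set_mem : rf => [x _ <-].
transitivity (c%:E * \int[mu]_x (\1_(f @^-1` [set c]) x)%:E).
  by rewrite -ge0_integralZl//; exact/measurable_EFinP.
rewrite integral_density_indic// -ge0_integralZl//.
- by apply: eq_integral => x _; rewrite EFinM muleA.
- by apply: emeasurable_funM; exact/measurable_EFinP.
- by move=> x _; rewrite mule_ge0// lee_fin.
Qed.

(** [muE] is the case of indicators; simple functions follow by linearity and the rest by monotone
    convergence. *)
Lemma ge0_integral_density (f : T -> \bar R) :
  measurable_fun setT f -> (forall x, 0 <= f x) ->
  \int[mu]_x f x = \int[m]_x (f x * (g x)%:E).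
Proof.
move=> mf f0; pose f_ := nnsfun_approx measurableT mf.
transitivity (lim (\int[mu]_x (f_ n x)%:E @[n --> \oo])).
  rewrite -monotone_convergence//=.
  - apply: eq_integral => t _; apply/esym/cvg_lim => //.
    exact: cvg_nnsfun_approx.
  - by move=> n; exact/measurable_EFinP/measurable_funTS.
  - by move=> n t _; rewrite lee_fin.
  - by move=> t _ i j ij; rewrite lee_fin; exact/lefP/nd_nnsfun_approx.
under eq_fun do rewrite integral_density_nnsfun.
rewrite -monotone_convergence//=.
- apply: eq_integral => t _; apply/cvg_lim => //.
  by apply: cvgeZr => //; exact: cvg_nnsfun_approx.
- by move=> n; apply: emeasurable_funM; exact/measurable_EFinP/measurable_funTS.
- by move=> n t _; rewrite mule_ge0// lee_fin.
- move=> t _ i j ij; apply: lee_wpmul2r; first by rewrite lee_fin.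
  by rewrite lee_fin; exact/lefP/nd_nnsfun_approx.
Qed.
End density.

Section log_concave.
Context {R : realType} {n : nat}.
Notation Rn := 'rV[R]_n.

(** [ln] has a default value at nonpositive reals, so the inequality is only stated between points
    of positivity, and positivity in between is a separate conclusion. *)
Definition log_concave (f : Rn -> R) :=
  (forall x, 0 <= f x) /\
  forall x y t, 0 < t < 1 -> 0 < f x -> 0 < f y ->
    0 < f (t *: x + (1 - t) *: y) /\
    t * ln (f x) + (1 - t) * ln (f y) <= ln (f (t *: x + (1 - t) *: y)).

Lemma log_concave_expeR (f : Rn -> R) (V : Rn -> \bar R) :
  convex_ereal V -> (forall x, (f x)%:E = expeR (- V x)%E) -> log_concave f.
Proof.
move=> [Vny Vconv] fV; split => [x|x y t t01].
  by rewrite -lee_fin fV expeR_ge0.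
(* Where [V] is infinite [f] vanishes, so positivity of [f] makes [V] finite and [ln] inverts the
   exponential. *)
have Vpos z : 0 < f z -> exists2 v, V z = v%:E & ln (f z) = - v.
  have := fV z; have := Vny z; case: (V z) => [v|//|//] _.
    by move=> [fz]; exists v => //; rewrite fz expRK.
  by move=> [->]; rewrite ltxx.
move=> /Vpos[u Vx ->] /Vpos[v Vy ->].
set z := _ + _; have := Vconv x y t t01; rewrite -/z Vx Vy.
have := Vny z; have := fV z; case: (V z) => [r|//|//] [->] _.
by rewrite -!EFinM -EFinD lee_fin expR_gt0 expRK => ?; split => //; lra.
Qed.

(** Convexity of superlevel sets at positive levels: [ln f] at the combination dominates an average
    of two numbers that are at least [ln c]. *)
Lemma log_concave_seg (f : Rn -> R) (x y : Rn) (t c : R) : log_concave f ->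
  0 <= t <= 1 -> 0 < c -> c <= f x -> c <= f y ->
  c <= f (t *: x + (1 - t) *: y).
Proof.
move=> [f0 flc] /andP[t0 t1] c0 cx cy.
have [->|tn0] := eqVneq t 0; first by rewrite scale0r add0r subr0 scale1r.
have [->|tn1] := eqVneq t 1; first by rewrite subrr scale0r addr0 scale1r.
have t01 : 0 < t < 1 by rewrite !lt_neqAle t0 t1 tn1 eq_sym tn0.
have fx := lt_le_trans c0 cx; have fy := lt_le_trans c0 cy.
have [fz h] := flc x y t t01 fx fy.
rewrite -ler_ln ?posrE//; apply: le_trans h.
have : ln c <= ln (f x) by rewrite ler_ln ?posrE.
have : ln c <= ln (f y) by rewrite ler_ln ?posrE.
by move: t0 t1 => t0 t1 h1 h2; nra.
Qed.

End log_concave.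

(** * Second moments *)

Section isotropic_log_concave.
Context {R : realType} {n : nat}.
Notation Rn := 'rV[R]_n.
Context (lam : {sigma_finite_measure set Rn -> \bar R}) (Hlam : is_lebesgue_Rn lam).
Context (mu : probability Rn R) (rho : Rn -> R).
Hypothesis mrho : measurable_fun setT rho.
Hypothesis rho_lc : log_concave rho.
Hypothesis muE : forall A, measurable A -> mu A = (\int[lam]_(x in A) (rho x)%:E)%E.
Hypothesis mu_iso : isotropic_with_const mu 1.

Let rho0 x : 0 <= rho x := rho_lc.1 x.

Lemma integral_rho : (\int[lam]_x (rho x)%:E = 1)%E.
Proof. by rewrite -muE// probability_setT. Qed.

Lemma integral_rho_affine (c : R) (v : Rn) : 0 < c ->
  (\int[lam]_x (rho (c *: x + v))%:E = (c ^- n)%:E)%E.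
Proof.
move=> c0; rewrite (ge0_integral_affine Hlam v (f := fun x => (rho x)%:E))//.
- by rewrite integral_rho mule1.
- exact/measurable_EFinP.
Qed.

(** [isotropic_with_const] gives values of integrals, not integrability; for a nonnegative integrand
    a finite value is enough. *)
Lemma isotropic_integrable_sqr (theta : Rn) :
  mu.-integrable setT (fun x => (dotRn x theta ^+ 2)%:E).
Proof.
apply/integrableP; split.
  by apply/measurable_EFinP; apply: measurable_funX; exact: measurable_dotRn.
under eq_integral do rewrite gee0_abs ?lee_fin ?sqr_ge0//.
by rewrite (mu_iso theta).2 ltry.
Qed.

Lemma isotropic_integrable (theta : Rn) :
  mu.-integrable setT (fun x => (dotRn x theta)%:E).
Proof.
apply: (@le_integrable _ _ _ _ _ _ _ (fun x => 1 + (dotRn x theta ^+ 2)%:E)%E) => //.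
- by apply/measurable_EFinP; exact: measurable_dotRn.
- move=> x _; rewrite -EFinD !abse_EFin lee_fin.
  rewrite (ger0_norm (x := 1 + _)) ?addr_ge0 ?sqr_ge0//.
  by rewrite ler_norml; apply/andP; split; nra.
- apply: integrableD => //; last exact: isotropic_integrable_sqr.
  exact: finite_measure_integrable_cst.
Qed.

Definition cube (x0 : Rn) (k : R) : set Rn :=
  [set x | forall i, `|(x - x0) ord0 i| <= k].

Lemma measurable_cube x0 k : measurable (cube x0 k).
Proof.
rewrite (_ : cube x0 k = \bigcap_(i in [set: 'I_n])
    ((fun x : Rn => x ord0 i) @^-1` `[x0 ord0 i - k, x0 ord0 i + k])).
  apply: fin_bigcap_measurable => // i _.
  by rewrite -[X in measurable X]setTI; exact: measurable_coord_rV.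
apply/seteqP; split => x /= hx i.
  move=> _; have := hx i; rewrite !mxE ler_norml /= in_itv/= => /andP[? ?].
  by apply/andP; split; lra.
have := hx i Logic.I; rewrite !mxE ler_norml /= in_itv/= => /andP[? ?].
by apply/andP; split; lra.
Qed.

Lemma integrable_sqdist (x0 : Rn) :
  mu.-integrable setT (fun x : Rn => (dotRn (x - x0) (x - x0))%:E).
Proof.
have mc i : mu.-integrable setT (fun x => ((x - x0) ord0 i ^+ 2)%:E).
  pose e : Rn := delta_mx ord0 i.
  have eE x : dotRn x e = x ord0 i.
    rewrite /dotRn (bigD1 i)//= mxE !eqxx mulr1 big1 ?addr0// => j ji.
    by rewrite mxE (negbTE ji) andbF mulr0.
  apply: (@le_integrable _ _ _ _ _ _ _ (fun x => (2 * dotRn x e ^+ 2)%:E +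
     (2 * dotRn x0 e ^+ 2)%:E)%E) => //.
  - apply/measurable_EFinP; apply: (measurable_funX (f := fun x : Rn => (x - x0) ord0 i)).
    rewrite (_ : (fun x => _) = (fun x : Rn => x ord0 i - x0 ord0 i)); last first.
      by apply/funext => x; rewrite !mxE.
    by apply: measurable_funB => //; exact: measurable_coord_rV.
  - move=> x _; rewrite -EFinD !abse_EFin lee_fin !eE.
    have -> : (x - x0) ord0 i = x ord0 i - x0 ord0 i by rewrite !mxE.
    set a := x ord0 i; set b := x0 ord0 i.
    have ab0 : 0 <= 2 * a ^+ 2 + 2 * b ^+ 2 by nra.
    by rewrite (ger0_norm (sqr_ge0 _)) (ger0_norm ab0); have := sqr_ge0 (a + b); nra.
  - apply: integrableD => //; last exact: finite_measure_integrable_cst.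
    under eq_fun do rewrite EFinM.
    exact: integrableZl (isotropic_integrable_sqr e).
rewrite (_ : (fun x => _) = (fun x => \sum_(i < n) ((x - x0) ord0 i ^+ 2)%:E)%E).
  by apply: integrable_sum => // i _; exact: mc.
by apply/funext => x; rewrite sumEFin.
Qed.

Lemma sqr_dotRn_center_le (x0 theta x : Rn) :
  dotRn (x - x0) theta ^+ 2 <= dotRn theta theta * dotRn (x - x0) (x - x0).
Proof. by rewrite mulrC; exact: dotRn_CS. Qed.

Lemma measurable_dotRn_center (x0 theta : Rn) :
  measurable_fun setT (fun x : Rn => dotRn (x - x0) theta ^+ 2).
Proof.
apply: (measurable_funX (f := fun x : Rn => dotRn (x - x0) theta)).
under eq_fun do rewrite dotRnBl.
by apply: measurable_funB => //; exact: measurable_dotRn.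
Qed.

Lemma integrable_sqr_center (x0 theta : Rn) :
  mu.-integrable setT (fun x : Rn => (dotRn (x - x0) theta ^+ 2)%:E).
Proof.
have intg := integrableZl measurableT (dotRn theta theta) (integrable_sqdist x0).
apply: (le_integrable _ _ _ intg) => //.
- by apply/measurable_EFinP; exact: measurable_dotRn_center.
- move=> x _; rewrite -EFinM !abse_EFin lee_fin.
  rewrite (ger0_norm (sqr_ge0 _)) (ger0_norm (mulr_ge0 (dotRn_ge0 _) (dotRn_ge0 _))).
  exact: sqr_dotRn_center_le.
Qed.

(** The mean is zero, so moving the center to [x0] adds the square of [dotRn x0 theta] to the second
    moment; that square is dropped. *)
Lemma isotropic_centered_ge (x0 theta : Rn) :
  ((dotRn theta theta)%:E <= \int[mu]_x (dotRn (x - x0)%R theta ^+ 2)%:E)%E.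
Proof.
set c := dotRn x0 theta.
have int1 := isotropic_integrable theta.
have int2 := isotropic_integrable_sqr theta.
have int3 := integrableZl measurableT (2 * c) int1.
apply: (@le_trans _ _ (\int[mu]_x ((dotRn x theta ^+ 2)%:E -
    (2 * c)%:E * (dotRn x theta)%:E))%E).
  rewrite integralB//= integralZl// (mu_iso theta).1 (mu_iso theta).2.
  by rewrite mule0 sube0 expr1n mul1r.
apply: le_integral => //; first exact: integrableB.
  exact: integrable_sqr_center.
move=> x _; rewrite -EFinM -EFinB lee_fin dotRnBl -/c.
by have := sqr_ge0 c; nra.
Qed.

(* The cube is chosen before the direction: the second moment of [mu] about
   [x0] puts a uniform share of every directional second moment inside it. *)
Lemma cube_tail (x0 : Rn) : exists k : nat,
  (\int[mu]_(x in ~` cube x0 k%:R) (dotRn (x - x0) (x - x0))%:E <= (2^-1)%:E)%E.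
Proof.
set f := fun x : Rn => (dotRn (x - x0) (x - x0))%:E.
have f0 x : (0 <= f x)%E by rewrite lee_fin dotRn_ge0.
have intf : mu.-integrable setT f := integrable_sqdist x0.
have mf : measurable_fun setT f by exact: measurable_int intf.
pose F (k : nat) := cube x0 k%:R.
have mF k : measurable (F k) by exact: measurable_cube.
have FT : \bigcup_k F k = setT.
  apply/seteqP; split => // x _; exists (Num.truncn `|x - x0|).+1 => //= i.
  by apply: le_trans (le_coord_norm_rV _ _) _; exact/ltW/truncnS_gt.
have cvgF : (\int[mu]_(x in F i) f x)%E @[i --> \oo] --> (\int[mu]_x f x)%E.
  rewrite -[X in integral _ X _]FT.
  apply: ge0_nondecreasing_set_cvg_integral => //.
  - move=> i j ij; apply/subsetPset => x /= hx l; apply: le_trans (hx l) _.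
    by rewrite ler_nat.
  - by move=> i; exact: measurable_funS mf.
have fT : (\int[mu]_x f x)%E \is a fin_num by exact: integrable_fin_num intf.
set T := (\int[mu]_x f x)%E in cvgF fT.
have nbT : nbhs T [set y : \bar R | (T - (2^-1)%:E < y)%E].
  apply: open_nbhs_nbhs; split; first exact: open_ereal_gt_ereal.
  by rewrite /= -(fineK fT) -EFinB lte_fin; lra.
have [k _ hk] := cvgF _ nbT.
have {}hk := hk k (leqnn k); rewrite /= in hk.
exists k; rewrite -/(F k).
have TE : (T = \int[mu]_(x in F k) f x + \int[mu]_(x in ~` F k) f x)%E.
  have mC : measurable (~` F k) by exact: measurableC.
  have mfU : measurable_fun (F k `|` ~` F k) f by rewrite setUv.
  have dj : [disjoint F k & ~` F k] by apply/disj_setPS; rewrite setICr.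
  by rewrite -ge0_integral_setU// setUv.
have : (0 <= \int[mu]_(x in F k) f x)%E by apply: integral_ge0.
have : (0 <= \int[mu]_(x in ~` F k) f x)%E by apply: integral_ge0.
move: hk TE fT; case: T {cvgF nbT} => [t| |]//.
case: (\int[mu]_(x in F k) f x)%E => [a| |]//;
  case: (\int[mu]_(x in ~` F k) f x)%E => [b| |]//.
by rewrite -EFinB -EFinD !lee_fin lte_fin => hk [tE] _ b0 a0; lra.
Qed.

End isotropic_log_concave.

(** * Superlevel sets *)

Section superlevel.
Context {R : realType} {n : nat}.
Notation Rn := 'rV[R]_n.
Context (lam : {sigma_finite_measure set Rn -> \bar R}) (Hlam : is_lebesgue_Rn lam).
Context (mu : probability Rn R) (rho : Rn -> R).
Hypothesis mrho : measurable_fun setT rho.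
Hypothesis rho_lc : log_concave rho.
Hypothesis muE : forall A, measurable A -> mu A = (\int[lam]_(x in A) (rho x)%:E)%E.
Hypothesis mu_iso : isotropic_with_const mu 1.

Let rho0 x : 0 <= rho x := rho_lc.1 x.

(** Recentered at [x0] and cut by a cube, to give the bounded convex set around the origin that
    [fat_chord] takes as [D]. *)
Definition superlevel (x0 : Rn) (k : R) : set Rn :=
  [set d | expR (-1) * rho x0 <= rho (x0 + d) /\ forall i, `|d ord0 i| <= k].

Lemma superlevel_conv x0 k x y t : 0 < rho x0 -> 0 <= t <= 1 ->
  superlevel x0 k x -> superlevel x0 k y -> superlevel x0 k (t *: x + (1 - t) *: y).
Proof.
move=> r0 t01 [rx xk] [ry yk]; split.
  have -> : x0 + (t *: x + (1 - t) *: y) = t *: (x0 + x) + (1 - t) *: (x0 + y).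
    rewrite !scalerDr addrACA -scalerDl (_ : t + (1 - t) = 1) ?scale1r//.
    by ring.
  by apply: log_concave_seg => //; rewrite mulr_gt0 ?expR_gt0.
move=> i; rewrite !mxE; have /andP[t0 t1] := t01.
apply: le_trans (ler_normD _ _) _; rewrite !normrM (ger0_norm t0).
have t1' : 0 <= 1 - t by lra.
rewrite (ger0_norm t1'); have := xk i; have := yk i => h1 h2.
have := ler_wpM2l t0 h2; have := ler_wpM2l t1' h1; lra.
Qed.

(* If [superlevel] is thin in direction [theta], then along the segment from
   [x0] to a far point [x] the function [ln rho] drops by at least [1] at each
   multiple of the width, so [rho x] is small compared with its midpoint. *)
Lemma thin_superlevel_decay (x0 theta x : Rn) (k w : R) :
  0 < rho x0 -> 0 < w -> 0 < dotRn theta theta ->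
  (forall d, superlevel x0 k d -> dotRn d theta ^+ 2 <= w ^+ 2 * dotRn theta theta) ->
  cube x0 k x ->
  dotRn (x - x0) theta ^+ 2 * rho x <=
  w ^+ 2 * dotRn theta theta * (4 * rho x + 64 * rho (2^-1 *: x + 2^-1 *: x0)).
Proof.
move=> r0 w0 q0 thin xcube.
set s := dotRn _ _; set q := dotRn _ _ in q0 thin *; set y : Rn := 2^-1 *: x + _.
have ry0 := rho0 y; have rx0 := rho0 x.
have wq : 0 < w ^+ 2 * q by rewrite mulr_gt0// exprn_gt0.
(* Within twice the width, the term [4 * rho x] alone suffices. *)
have [sle|slt] := leP (s ^+ 2) (4 * (w ^+ 2 * q)).
  by have := ler_wpM2r rx0 sle; nra.
have [rx|rxp] := eqVneq (rho x) 0; first by rewrite rx; nra.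
have {rxp}rx : 0 < rho x by rewrite lt_neqAle eq_sym rxp rx0.
have sn0 : s != 0 by apply: contraTneq slt => ->; rewrite -leNgt expr0n/=; lra.
have as0 : 0 < `|s| by rewrite normr_gt0.
pose sig := Num.sqrt q.
have sig2 : sig ^+ 2 = q by rewrite sqr_sqrtr// ltW.
have sig0 : 0 < sig by rewrite sqrtr_gt0.
have s2 : `|s| ^+ 2 = s ^+ 2 by rewrite real_normK ?num_real.
(* Chosen so that [x0 + l *: (x - x0)] lies at twice the width from [x0] in direction [theta]. It is
   still in the cube, so it can only leave [superlevel] by having density below [rho x0 / e]. *)
pose l := 2 * w * sig / `|s|.
have l0 : 0 < l by rewrite divr_gt0// !mulr_gt0.
have l2 : l ^+ 2 * s ^+ 2 = 4 * (w ^+ 2 * q).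
  by rewrite -s2 -sig2 /l; field; rewrite normr_eq0.
have l1 : l < 1.
  rewrite ltr_pdivrMr// mul1r -ltr_sqr ?nnegrE ?mulr_ge0 ?ltW// s2.
  by apply: le_lt_trans slt; rewrite -sig2 !exprMn; lra.
have notD : ~ superlevel x0 k (l *: (x - x0)).
  by move=> /thin; rewrite dotRnZl exprMn l2; lra.
have zlt : rho (x0 + l *: (x - x0)) < expR (-1) * rho x0.
  rewrite ltNge; apply/negP => h; apply: notD; split => // i.
  rewrite mxE normrM (gtr0_norm l0); apply: le_trans (xcube i).
  by rewrite ler_piMl// ltW.
have zE : x0 + l *: (x - x0) = l *: x + (1 - l) *: x0.
  by rewrite scalerBr scalerBl scale1r addrCA addrC -addrA addrC -addrA [- _ + _]addrC.
rewrite zE in zlt.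
have l01 : 0 < l < 1 by rewrite l0 l1.
have [rz lnz] := rho_lc.2 x x0 l l01 rx r0.
have {}zlt : ln (rho (l *: x + (1 - l) *: x0)) < ln (rho x0) - 1.
  have : ln (rho (l *: x + (1 - l) *: x0)) < ln (expR (-1) * rho x0).
    by rewrite ltr_ln ?posrE// mulr_gt0 ?expR_gt0.
  by rewrite lnM ?posrE ?expR_gt0// expRK; lra.
pose a := ln (rho x0) - ln (rho x).
have la : 1 < l * a by rewrite /a; lra.
have a0 : 0 < a by rewrite -(pmulr_rgt0 _ l0); lra.
have h01 : 0 < (2^-1 : R) < 1 by lra.
have [ry lny] := rho_lc.2 x x0 2^-1 h01 rx r0.
have yE : 2^-1 *: x + (1 - 2^-1) *: x0 = y.
  by rewrite /y; congr (_ + _ *: _); lra.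
rewrite yE in ry lny.
(* At the midpoint [ln rho] exceeds [ln (rho x)] by at least [a / 2], and the exponential of [a / 2]
   is at least the square of [1 + a / 4]. *)
have rxy : rho x * (a ^+ 2 / 16) <= rho y.
  apply: (@le_trans _ _ (rho x * expR (a / 2))).
    rewrite ler_wpM2l//.
    have -> : a / 2 = a / 4 + a / 4 by lra.
    rewrite expRD; have := expR_ge1Dx (a / 4) => h.
    by have : 1 + a / 4 <= expR (a / 4) by []; nra.
  rewrite -ler_ln ?posrE ?mulr_gt0 ?expR_gt0// lnM ?posrE ?expR_gt0// expRK.
  by rewrite /a; lra.
(* From [l * a > 1]; with [rxy] this produces the constant 64 as 4 times 16. *)
have sa : s ^+ 2 <= 4 * (w ^+ 2 * q) * a ^+ 2.
  by rewrite -l2; have := sqr_ge0 s; have : 1 <= l ^+ 2 * a ^+ 2; nra.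
have h1 := ler_wpM2r rx0 sa.
have h2 := ler_wpM2l (ltW wq) rxy.
by nra.
Qed.

(** Small enough for [width_small]: the moment inside the cube stays below half of
    [dotRn theta theta], the other half being left to the outside. *)
Definition width : R := (12 * 2 ^+ n)^-1.

Lemma width_gt0 : 0 < width.
Proof. by rewrite invr_gt0 mulr_gt0// exprn_gt0. Qed.

Lemma width_small : width ^+ 2 * (4 + 64 * 2 ^+ n) < 2^-1.
Proof.
rewrite /width; set N : R := 2 ^+ n.
have N1 : 1 <= N by rewrite exprn_ege1// ler1n.
rewrite exprVn mulrC ltr_pdivrMr; first nra.
by rewrite exprn_gt0// mulr_gt0//; lra.
Qed.

(** If fatness failed for some [theta], the second moment about [x0] would be at most [q / 2]
    outside the cube and less than [q / 2] inside, against [isotropic_centered_ge]. *)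
Lemma superlevel_fat (x0 : Rn) : 0 < rho x0 -> exists k : nat,
  forall theta, theta != 0 ->
  exists2 d, superlevel x0 k%:R d & width ^+ 2 * dotRn theta theta < dotRn d theta ^+ 2.
Proof.
move=> r0; have [k hk] := cube_tail mu_iso x0; exists k => theta theta0.
set q := dotRn theta theta.
have q0 : 0 < q.
  rewrite lt_neqAle dotRn_ge0 andbT eq_sym.
  by apply: contra_neq theta0; exact: dotRn_eq0.
apply: contrapT => /forall2NP nofat.
have thin d : superlevel x0 k%:R d -> dotRn d theta ^+ 2 <= width ^+ 2 * q.
  by move=> Dd; have [//|/negP] := nofat d; rewrite -leNgt.
pose F := cube x0 k%:R; have mF : measurable F := measurable_cube x0 _.
have mC : measurable (~` F) by exact: measurableC.
pose s2 (x : Rn) := dotRn (x - x0) theta ^+ 2.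
have ms2 : measurable_fun setT s2 := measurable_dotRn_center x0 theta.
have out : (\int[mu]_(x in ~` F) (s2 x)%:E <= (q / 2)%:E)%E.
  apply: (@le_trans _ _ (\int[mu]_(x in ~` F) (q%:E * (dotRn (x - x0) (x - x0))%:E))%E).
    apply: le_integral => //.
    - apply: integrableS (integrable_sqr_center mu_iso x0 theta) => //.
    - apply: (@integrableS _ _ _ _ setT) => //.
      exact: integrableZl (integrable_sqdist mu_iso x0).
    - by move=> x _; rewrite -EFinM lee_fin; exact: sqr_dotRn_center_le.
  rewrite ge0_integralZl ?lee_fin ?(ltW q0)//.
  - by rewrite EFinM; apply: lee_wpmul2l => //; rewrite lee_fin ltW.
  - by apply: measurable_funS (measurable_int mu (integrable_sqdist mu_iso x0)).
  - by move=> x _; rewrite lee_fin dotRn_ge0.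
have mrho2 : measurable_fun setT (fun x : Rn => rho (2^-1 *: x + 2^-1 *: x0)).
  exact: (measurableT_comp mrho (@measurable_affine_rV R n _ _)).
(* The decay bound holds pointwise on the cube; in its second term the halving map multiplies the
   mass of [rho] by [2 ^+ n]. *)
have inn : (\int[mu]_(x in F) (s2 x)%:E <= (width ^+ 2 * q * (4 + 64 * 2 ^+ n))%:E)%E.
  rewrite integral_mkcond.
  rewrite (_ : (_ \_ F) = fun x => (s2 x * \1_F x)%:E); last first.
    apply/funext => x; rewrite patchE indicE.
    by case: ifPn => _; rewrite ?mulr1 ?mulr0.
  rewrite (ge0_integral_density mrho rho0 muE); last 2 first.
  - by apply/measurable_EFinP; apply: measurable_funM => //; exact: measurable_indic.
  - by move=> x; rewrite lee_fin; apply: mulr_ge0 => //; exact: sqr_ge0.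
  apply: (@le_trans _ _ (\int[lam]_x ((width ^+ 2 * q)%:E *
     (4%:E * (rho x)%:E + 64%:E * (rho (2^-1 *: x + 2^-1 *: x0)%R)%:E)))%E).
    apply: ge0_le_integral => //.
    - move=> x _; rewrite -EFinM lee_fin; apply: mulr_ge0 => //.
      by apply: mulr_ge0 => //; exact: sqr_ge0.
    - apply: emeasurable_funM; apply/measurable_EFinP => //.
      by apply: measurable_funM => //; exact: measurable_indic.
    - apply: measurable_funeM; apply: emeasurable_funD;
        apply: measurable_funeM; exact/measurable_EFinP.
    - move=> x _; rewrite -!EFinM lee_fin indicE.
      have [/set_mem xF|_] := boolP (x \in F).
        by rewrite mulr1; exact: (thin_superlevel_decay r0 width_gt0 q0 thin xF).
      rewrite mulr0 mul0r; apply: mulr_ge0.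
        by apply: mulr_ge0; [exact: sqr_ge0|exact: ltW].
      by apply: addr_ge0; apply: mulr_ge0.
  have wq0 : (0 <= (width ^+ 2 * q)%:E)%E.
    by rewrite lee_fin; apply: mulr_ge0; [exact: sqr_ge0|exact: ltW].
  rewrite ge0_integralZl//; last 2 first.
  - apply: emeasurable_funD; apply: measurable_funeM; exact/measurable_EFinP.
  - by move=> x _; rewrite -!EFinM lee_fin; apply: addr_ge0; apply: mulr_ge0.
  rewrite ge0_integralD//; last 4 first.
  - by move=> x _; rewrite -EFinM lee_fin mulr_ge0.
  - by apply: measurable_funeM; exact/measurable_EFinP.
  - by move=> x _; rewrite -EFinM lee_fin mulr_ge0.
  - by apply: measurable_funeM; exact/measurable_EFinP.
  rewrite !ge0_integralZl//; last 4 first.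
  - exact/measurable_EFinP.
  - by move=> x _; rewrite lee_fin.
  - exact/measurable_EFinP.
  - by move=> x _; rewrite lee_fin.
  rewrite (integral_rho muE) (integral_rho_affine Hlam mrho rho_lc muE) ?invr_gt0//.
  have -> : (2^-1 : R) ^- n = 2 ^+ n by rewrite exprVn invrK.
  by rewrite -!EFinM mulr1.
have := isotropic_centered_ge mu_iso x0 theta; rewrite -/q.
have -> : (\int[mu]_x (s2 x)%:E =
    \int[mu]_(x in F) (s2 x)%:E + \int[mu]_(x in ~` F) (s2 x)%:E)%E.
  rewrite -ge0_integral_setU// ?setUv//; first exact/measurable_EFinP.
    by move=> x _; rewrite lee_fin sqr_ge0.
  by apply/disj_setPS; rewrite setICr.
move=> /le_trans/(_ (leeD inn out)); rewrite -EFinD lee_fin.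
by have := width_small; have := width_gt0; nra.
Qed.

Lemma superlevel_chord (x0 h : Rn) : 0 < rho x0 -> dotRn h h = 1 ->
  exists p, forall t, 0 <= t <= width / (2 * n.+1%:R) ->
    expR (-1) * rho x0 <= rho (p + t *: h).
Proof.
move=> r0 hh; have [k fat] := superlevel_fat r0.
have D0 : superlevel x0 k%:R 0.
  split=> [|i]; last by rewrite mxE normr0.
  rewrite addr0 -[leRHS]mul1r; apply: ler_wpM2r; first exact: rho0.
  by rewrite -[leRHS]expR0 ler_expR; lra.
have Dconv x y t : 0 <= t <= 1 -> superlevel x0 k%:R x ->
    superlevel x0 k%:R y -> superlevel x0 k%:R (t *: x + (1 - t) *: y).
  exact: superlevel_conv.
have Db d i : superlevel x0 k%:R d -> `|d ord0 i| <= k%:R by move=> [].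
have [d1 [d2 [[D1 _] [D2 _] d12]]] := fat_chord D0 Dconv Db fat hh.
set r := width / _ in d12 *.
have rp : 0 < r by rewrite divr_gt0 ?width_gt0// mulr_gt0// ltr0n.
(* The chord runs from [x0 + d2] to [x0 + d1]; points in between inherit the level by convexity. *)
exists (x0 + d2) => t /andP[t0 tr].
have -> : x0 + d2 + t *: h = (t / r) *: (x0 + d1) + (1 - t / r) *: (x0 + d2).
  have -> : x0 + d1 = x0 + d2 + r *: h by rewrite -d12 -addrA [d2 + _]addrC subrK.
  rewrite scalerDr scalerA divfK ?gt_eqF// [RHS]addrAC -scalerDl.
  by rewrite (_ : t / r + (1 - t / r) = 1) ?scale1r//; ring.
apply: log_concave_seg => //; last by rewrite mulr_gt0 ?expR_gt0.
by rewrite divr_ge0 ?(ltW rp)//= ler_pdivrMr// mul1r.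
Qed.

End superlevel.

(** * The measure of the set of chords *)

(** The supremum of the density is not known to be finite or attained, so the levels are exhausted
    by a sequence [N], each term of which is dominated by some value; [chords_le_bound] then applies
    to each term. *)
Lemma cofinal_values (R : realType) (T : pointedType) (f : T -> R) :
  exists N : nat -> R,
    [/\ {homo N : i j / (i <= j)%N >-> i <= j},
        forall k, exists x, N k <= f x &
        forall x s, s < f x -> exists k, s <= N k].
Proof.
have [ubf|nubf] := pselect (has_ubound (range f)).
  exists (fun k => sup (range f) - k.+1%:R^-1); split.
  - by move=> i j ij; rewrite lerB// lef_pV2 ?posrE ?ltr0n// ler_nat ltnS.
  - move=> k; have [_ [x _ <-] /ltW fx] : exists2 y, range f y &
        sup (range f) - k.+1%:R^-1 < y.
      apply: sup_gt; first by exists (f point); exists point.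
      by rewrite gtrBl invr_gt0 ltr0n.
    by exists x.
  - move=> x s sx.
    have sS : 0 < sup (range f) - s.
      by rewrite subr_gt0; apply: lt_le_trans sx _; apply: ub_le_sup => //; exists x.
    exists (Num.truncn (sup (range f) - s)^-1).
    rewrite lerBrDr -lerBrDl -[leRHS]invrK lef_pV2 ?posrE ?invr_gt0 ?ltr0n//.
    exact/ltW/truncnS_gt.
exists (fun k => k%:R); split.
- by move=> i j ij; rewrite ler_nat.
- move=> k; apply: contrapT => /forallNP h; apply: nubf; exists k%:R.
  by move=> _ [x _ <-]; have /negP := h x; rewrite -ltNge => /ltW.
- by move=> x s _; exists (Num.truncn s).+1; exact/ltW/truncnS_gt.
Qed.

Section chords.
Context {R : realType} {n : nat}.
Notation Rn := 'rV[R]_n.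
Notation leb := (@lebesgue_measure R).
Context (lam : {sigma_finite_measure set Rn -> \bar R}) (Hlam : is_lebesgue_Rn lam).
Context (mu : probability Rn R) (rho : Rn -> R).
Hypothesis mrho : measurable_fun setT rho.
Hypothesis rho_lc : log_concave rho.
Hypothesis muE : forall A, measurable A -> mu A = (\int[lam]_(x in A) (rho x)%:E)%E.
Hypothesis mu_iso : isotropic_with_const mu 1.
Context (h : Rn) (hh : dotRn h h = 1).

Let rho0 x : 0 <= rho x := rho_lc.1 x.

(* Pairs (line in direction [h], level); asking for a rational parameter makes
   the set measurable, and only discards superlevel sets that are one point. *)
Definition chords : set (Rn * R) :=
  [set z | [/\ slab h z.1, 0 < z.2 & exists q : rat, z.2 < rho (z.1 + ratr q *: h)]].

Lemma measurable_gt_line (t : R) :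
  measurable [set z : Rn * R | z.2 < rho (z.1 + t *: h)].
Proof.
have m1 : measurable_fun setT (fun z : Rn * R => rho (z.1 + t *: h)).
  apply: (measurableT_comp mrho).
  apply: (@measurableT_comp _ _ _ _ _ _ _ _ (fun z : Rn * R => (z.1, t))
    (@measurable_line_rV R n h)).
  exact: measurable_fun_pair.
rewrite (_ : [set _ | _] = (fun z : Rn * R => z.2 < rho (z.1 + t *: h)) @^-1` [set true]).
  by rewrite -[X in measurable X]setTI; apply: measurable_fun_ltr.
by apply/seteqP; split.
Qed.

Lemma measurable_snd_lt (s : R) : measurable [set z : Rn * R | s < z.2].
Proof.
rewrite (_ : [set _ | _] = setT `*` `]s, +oo[).
  by apply: measurableX.
by apply/seteqP; split => z /=; rewrite in_itv/= andbT => // -[].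
Qed.

Lemma measurable_chords : measurable chords.
Proof.
rewrite (_ : chords = (slab h `*` setT) `&` [set z | 0 < z.2] `&`
    \bigcup_(q : rat) [set z | z.2 < rho (z.1 + ratr q *: h)]).
  apply: measurableI; last first.
    by apply: bigcupT_measurable_rat => q; exact: measurable_gt_line.
  apply: measurableI; last exact: measurable_snd_lt.
  by apply: measurableX => //; exact: measurable_slab.
apply/seteqP; split => z /=.
  by move=> [? ? [q ?]]; split => //; exists q.
by move=> [[[? _] ?] [q _ ?]]; split => //; exists q.
Qed.

Definition chord_len : R := @width R n / (2 * n.+1%:R).

Lemma chord_len_gt0 : 0 < chord_len.
Proof. by rewrite divr_gt0 ?width_gt0// mulr_gt0// ltr0n. Qed.

Definition chords_bound : R := expR 2^-1 * 2 ^+ n / chord_len.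

(* Averaging each chord at level [s <= rho x0] with a chord of [rho] of length
   [chord_len] at level [rho x0 / e] gives a chord, half as long, of [rho] at
   level [s / sqrt e]; all of these fit in a homothetic copy of [mu]. *)
Lemma chords_le_bound (x0 : Rn) (N : R) : N <= rho x0 ->
  ((lam \x leb) (chords `&` [set z | (z.2 <= N)%R]) <= chords_bound%:E)%E.
Proof.
move=> Nx0; set EN := chords `&` _.
have bnd0 : (0 <= chords_bound%:E)%E.
  rewrite lee_fin; apply: divr_ge0; last exact/ltW/chord_len_gt0.
  by apply: mulr_ge0; [exact: expR_ge0|exact: exprn_ge0].
have [Np|N0] := leP N 0.
  rewrite (_ : EN = set0) ?measure0//.
  by apply/seteqP; split => // z [[_ z0 _]] /= zN; lra.
have r0 : 0 < rho x0 := lt_le_trans N0 Nx0.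
have [p hp] := superlevel_chord Hlam mrho rho_lc muE mu_iso r0 hh.
(* [g] is [rho] dilated by two, which restores the halved chords to length [chord_len]; the factor
   in [f] brings level [s / sqrt e] back to [s]. *)
pose g (y : Rn) := rho (2^-1 *: y + 2^-1 *: p).
pose f (y : Rn) := expR 2^-1 * g y.
have mf : measurable_fun setT f.
  apply: measurable_funM => //.
  exact: (measurableT_comp mrho (@measurable_affine_rV R n _ _)).
have f0 y : 0 <= f y by apply: mulr_ge0; [exact: expR_ge0|exact: rho0].
have mEN : measurable EN.
  apply: measurableI; first exact: measurable_chords.
  rewrite (_ : [set _ | _] = ~` [set z : Rn * R | N < z.2]).
    by apply: measurableC; exact: measurable_snd_lt.
  by apply/seteqP; split => z /=; rewrite ltNge; [move=> ->|move/negP/negPn].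
have intf : (\int[lam]_x (1 * f x)%:E = (expR 2^-1 * 2 ^+ n)%:E)%E.
  under eq_integral do rewrite mul1r EFinM.
  rewrite ge0_integralZl//.
  - rewrite (integral_rho_affine Hlam mrho rho_lc muE) ?invr_gt0//.
    by rewrite exprVn invrK.
  - apply/measurable_EFinP.
    exact: (measurableT_comp mrho (@measurable_affine_rV R n _ _)).
  - by move=> x _; rewrite lee_fin; exact: rho0.
have m1 : measurable_fun setT (cst 1 : Rn -> R) by [].
have ge01 (x : Rn) : 0 <= (cst 1 : Rn -> R) x by [].
have mL := measurable_line_layer h m1 mf ge01.
have mS : measurable (slab h `*` [set: R]).
  by apply: measurableX => //; exact: measurable_slab.
have long z : EN z -> (chord_len%:E <= line_layer h (cst 1%R) f z)%E.
  move=> [[zW z0 [q zq]] /= zN].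
  apply: (@le_trans _ _ (\int[leb]_t (\1_`[ratr q, ratr q + chord_len] t)%:E)%E).
    rewrite integral_indic//= setIT lebesgue_measure_itv/= lte_fin ltrDl chord_len_gt0.
    by rewrite -EFinB addrC addKr.
  apply: ge0_le_integral => //.
  - by apply/measurable_EFinP; exact: measurable_indic.
  - apply/measurable_EFinP.
    apply: (@measurableT_comp _ _ _ _ _ _ _ _ (fun t : R => (z, t))
      (measurable_layer_line h m1 mf)).
    exact: measurable_fun_pair.
  move=> t _; rewrite lee_fin /= mul1r indicE.
  have [|//] := boolP (t \in _); rewrite inE/= in_itv/= => /andP[qt tq].
  rewrite indicE mem_set//= in_itv/= z0/=.
  (* [u] is fixed on the given chord while [v] runs along the long one; their midpoint is where [g]
     samples [rho] at parameter [t]. *)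
  pose u := z.1 + ratr q *: h; pose v := p + (t - ratr q) *: h.
  have ru : 0 < rho u by exact: lt_trans z0 zq.
  have rv : expR (-1) * rho x0 <= rho v.
    by apply: hp; rewrite -/chord_len; apply/andP; split; lra.
  have ev : 0 < expR (-1) * rho x0 by rewrite mulr_gt0 ?expR_gt0.
  have rv0 : 0 < rho v := lt_le_trans ev rv.
  have h01 : 0 < (2^-1 : R) < 1 by lra.
  have [gp lg] := rho_lc.2 u v 2^-1 h01 ru rv0.
  have uvE : 2^-1 *: u + (1 - 2^-1) *: v = 2^-1 *: (z.1 + t *: h) + 2^-1 *: p.
    rewrite (_ : 1 - 2^-1 = 2^-1 :> R); last lra.
    rewrite -!scalerDr /u /v addrACA -scalerDl.
    by rewrite (_ : ratr q + (t - ratr q) = t) ?[z.1 + p + _]addrAC//; lra.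
  rewrite uvE in gp lg.
  rewrite -ltr_ln ?posrE ?mulr_gt0 ?expR_gt0// lnM ?posrE ?expR_gt0// expRK.
  have l1 : ln (expR (-1) * rho x0) <= ln (rho v) by rewrite ler_ln ?posrE.
  rewrite lnM ?posrE ?expR_gt0// expRK in l1.
  have l2 : ln z.2 < ln (rho u) by rewrite ltr_ln ?posrE.
  (* The loss [1 / 2] from averaging with [ln (rho x0) - 1] is repaid by the factor [expR 2^-1]. *)
  have l3 : ln z.2 <= ln (rho x0) by rewrite ler_ln ?posrE//; lra.
  by rewrite /g; lra.
(* Markov's inequality: the chord lengths of [f] integrate to its mass and are at least [chord_len]
   on [EN]. *)
have key : (chord_len%:E * (lam \x leb) EN <= (expR 2^-1 * 2 ^+ n)%:E)%E.
  rewrite -intf (ge0_integral_line_layer Hlam hh (psi := cst 1))//.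
  rewrite -integral_cst//.
  apply: (@le_trans _ _ (\int[lam \x leb]_(z in EN) line_layer h (cst 1%R) f z)%E).
    apply: ge0_le_integral => //.
    - by move=> z _; rewrite lee_fin ltW// chord_len_gt0.
    - exact: measurable_funS mL.
  apply: ge0_subset_integral => //.
  - exact: measurable_funS mL.
  - by move=> z _; exact: line_layer_ge0.
  - by move=> z [[zW _ _] _]; split.
by rewrite /chords_bound EFinM lee_pdivlMr ?chord_len_gt0// muleC.
Qed.

Lemma measure_chords_le : ((lam \x leb) chords <= chords_bound%:E)%E.
Proof.
have [N [Nhomo Nex Ncof]] := cofinal_values rho.
pose E k := chords `&` [set z : Rn * R | z.2 <= N k].
have mE k : measurable (E k).
  apply: measurableI; first exact: measurable_chords.
  rewrite (_ : [set _ | _] = ~` [set z : Rn * R | N k < z.2]).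
    by apply: measurableC; exact: measurable_snd_lt.
  by apply/seteqP; split => z /=; rewrite ltNge; [move=> ->|move/negP/negPn].
have EU : \bigcup_k E k = chords.
  apply/seteqP; split => [z [k _ []]//|z hz].
  have [_ _ [q /Ncof[k zk]]] := hz.
  by exists k.
have cvgE : ((lam \x leb)%E \o E) x @[x --> \oo] --> (lam \x leb)%E chords.
  rewrite -EU; apply: nondecreasing_cvg_mu => //.
  - by rewrite EU; exact: measurable_chords.
  - move=> i j ij; apply/subsetPset => z [zE /= zN]; split => //=.
    exact: le_trans zN (Nhomo _ _ ij).
rewrite -(cvg_lim _ cvgE)//; apply: lime_le.
  by apply/cvg_ex; eexists; exact: cvgE.
by apply: nearW => k /=; have [x0 Nx0] := Nex k; exact: chords_le_bound Nx0.
Qed.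

End chords.

(** * Endpoints of chords *)

Section endpoints.
Context {R : realType} {n : nat}.
Notation Rn := 'rV[R]_n.
Notation leb := (@lebesgue_measure R).
Context (rho : Rn -> R).
Hypothesis mrho : measurable_fun setT rho.
Hypothesis rho_lc : log_concave rho.
Context (h : Rn).
Notation chords := (chords rho h).

(** Rational parameters only, so that comparing an endpoint with a number becomes a countable union
    of measurable conditions. *)
Definition chord_rat (z : Rn * R) : set R :=
  [set ratr q | q in [set q : rat | z.2 < rho (z.1 + ratr q *: h)]].

Definition chord_lo (z : Rn * R) : R := inf (chord_rat z).
Definition chord_hi (z : Rn * R) : R := sup (chord_rat z).

(** The pairs for which [inf] and [sup] are true endpoints rather than default values. *)
Definition bounded_chords : set (Rn * R) :=
  chords `&` \bigcup_(k : nat) [set z | forall t, chord_rat z t -> `|t| <= k%:R].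

Lemma measurable_bounded_chords : measurable bounded_chords.
Proof.
apply: measurableI; first exact: measurable_chords.
apply: bigcup_measurable => k _.
rewrite (_ : [set _ | _] = ~` \bigcup_(q in [set q : rat | k%:R < `|ratr q : R|])
    [set z : Rn * R | z.2 < rho (z.1 + ratr q *: h)]).
  apply: measurableC; apply: countable_bigcup_measurable => q _.
  exact: measurable_gt_line.
apply/seteqP; split => z /=.
  move=> zk [q /= qk zq]; have : `|ratr q : R| <= k%:R by apply: zk; exists q.
  by rewrite leNgt qk.
move=> nz _ [q zq <-]; rewrite leNgt; apply/negP => qk; apply: nz.
by exists q.
Qed.

Lemma bounded_chordsP z : bounded_chords z ->
  [/\ chord_rat z !=set0, has_lbound (chord_rat z) & has_ubound (chord_rat z)].
Proof.
move=> [[_ _ [q zq]] [k _ /= zk]]; split.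
- by exists (ratr q); exists q.
- by exists (- k%:R) => t /zk; rewrite ler_norml => /andP[].
- by exists k%:R => t /zk; rewrite ler_norml => /andP[].
Qed.

Lemma measurable_chord_lo : measurable_fun bounded_chords chord_lo.
Proof.
apply: (measurability (@RGenInftyO.G R)); first exact: RGenInftyO.measurableE.
move=> _ [_ [y ->] <-].
rewrite (_ : _ `&` _ = bounded_chords `&` \bigcup_(q in [set q : rat | (ratr q : R) < y])
    [set z : Rn * R | z.2 < rho (z.1 + ratr q *: h)]).
  apply: measurableI; first exact: measurable_bounded_chords.
  by apply: countable_bigcup_measurable => q _; exact: measurable_gt_line.
apply/seteqP; split => z /= [zg].
  rewrite in_itv/= => zy; split => //.
  have [z0 _ _] := bounded_chordsP zg.
  by have [_ [q zq <-] qy] := inf_lt z0 zy; exists q.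
move=> [q /= qy zq]; split => //; rewrite in_itv/=.
apply: le_lt_trans qy; have [_ zl _] := bounded_chordsP zg.
by apply: ge_inf => //; exists q.
Qed.

Lemma measurable_chord_hi : measurable_fun bounded_chords chord_hi.
Proof.
apply: (measurability (@RGenOInfty.G R)); first exact: RGenOInfty.measurableE.
move=> _ [_ [y ->] <-].
rewrite (_ : _ `&` _ = bounded_chords `&` \bigcup_(q in [set q : rat | y < (ratr q : R)])
    [set z : Rn * R | z.2 < rho (z.1 + ratr q *: h)]).
  apply: measurableI; first exact: measurable_bounded_chords.
  by apply: countable_bigcup_measurable => q _; exact: measurable_gt_line.
apply/seteqP; split => z /= [zg].
  rewrite in_itv/= andbT => zy; split => //.
  have [z0 _ _] := bounded_chordsP zg.
  by have [_ [q zq <-] qy] := sup_gt z0 zy; exists q.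
move=> [q /= qy zq]; split => //; rewrite in_itv/= andbT.
apply: lt_le_trans qy _; have [_ _ zl] := bounded_chordsP zg.
by apply: ub_le_sup => //; exists q.
Qed.

Lemma line_between (x : Rn) (s t1 t2 t : R) : 0 < s -> t1 <= t <= t2 ->
  s < rho (x + t1 *: h) -> s < rho (x + t2 *: h) -> s < rho (x + t *: h).
Proof.
move=> s0 /andP[t1t tt2] s1 s2.
have [->//|t12] := eqVneq t t1.
have lt12 : t1 < t2 by apply: lt_le_trans tt2; rewrite lt_neqAle eq_sym t12.
have d0 : 0 < t2 - t1 by rewrite subr_gt0.
pose l := (t2 - t) / (t2 - t1).
have l01 : 0 <= l <= 1.
  apply/andP; split; first by apply: divr_ge0; lra.
  by rewrite /l ler_pdivrMr// mul1r; lra.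
pose c := Num.min (rho (x + t1 *: h)) (rho (x + t2 *: h)).
have sc : s < c by rewrite lt_min s1 s2.
have -> : x + t *: h = l *: (x + t1 *: h) + (1 - l) *: (x + t2 *: h).
  rewrite !scalerDr addrACA -scalerDl !scalerA -scalerDl.
  rewrite (_ : l + (1 - l) = 1) ?scale1r; last by ring.
  congr (_ + _ *: _); rewrite /l; field; exact: lt0r_neq0.
apply: (lt_le_trans sc); apply: log_concave_seg => //.
- exact: lt_trans sc.
- by rewrite ge_min lexx.
- by rewrite ge_min lexx orbT.
Qed.

Lemma chord_rat_between z t1 t2 : 0 < z.2 -> t1 < t2 ->
  z.2 < rho (z.1 + t1 *: h) -> z.2 < rho (z.1 + t2 *: h) ->
  exists2 t, t1 < t < t2 & chord_rat z t.
Proof.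
move=> z0 t12 z1 z2; have [q] := rat_in_itvoo t12.
rewrite in_itv/= => /andP[q1 q2]; exists (ratr q); first exact/andP.
by exists q => //=; apply: line_between z1 z2; rewrite // !ltW.
Qed.

(** A real parameter beyond an endpoint would, by convexity of the chord, force a rational one
    beyond it too. *)
Lemma chord_hull z t : bounded_chords z ->
  z.2 < rho (z.1 + t *: h) -> chord_lo z <= t <= chord_hi z.
Proof.
move=> zg zt; have [[_ z0 _] _] := zg; have [S0 Sl Su] := bounded_chordsP zg.
apply/andP; split; rewrite leNgt; apply/negP => tz.
  have [_ [q /= zq _]] := S0.
  have tq : t < ratr q by apply: lt_le_trans tz _; apply: ge_inf => //; exists q.
  have [q' /= ] := rat_in_itvoo tz; rewrite in_itv/= => /andP[tq' q'z].
  suff : chord_lo z <= (ratr q' : R) by rewrite leNgt q'z.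
  apply: ge_inf => //; exists q' => //=; apply: (line_between z0 _ zt zq).
  rewrite (ltW tq') /=; apply: le_trans (ltW q'z) _.
  by apply: ge_inf => //; exists q.
have [_ [q /= zq _]] := S0.
have [q' /= ] := rat_in_itvoo tz; rewrite in_itv/= => /andP[zq' q't].
suff : ratr q' <= chord_hi z by rewrite leNgt zq'.
apply: ub_le_sup => //; exists q' => //=; apply: (line_between z0 _ zq zt).
rewrite (ltW q't) andbT; apply: le_trans (ltW zq').
by apply: ub_le_sup => //; exists q.
Qed.

Lemma chord_interior z t : bounded_chords z ->
  chord_lo z < t < chord_hi z -> z.2 < rho (z.1 + t *: h).
Proof.
move=> zg /andP[lt th]; have [[_ z0 _] _] := zg; have [S0 _ _] := bounded_chordsP zg.
have [_ [q zq <-] qt] := inf_lt S0 lt; have [_ [q' zq' <-] tq'] := sup_gt S0 th.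
by apply: line_between zq zq'; rewrite // !ltW.
Qed.

Lemma chord_lo_le_hi z : bounded_chords z -> chord_lo z <= chord_hi z.
Proof.
move=> zg; have [[t zt] Sl Su] := bounded_chordsP zg.
by apply: (@le_trans _ _ t); [exact: ge_inf|exact: ub_le_sup].
Qed.

Section line_layer_chord.
Context (psi : Rn -> R).
Hypothesis mpsi : measurable_fun setT psi.

Lemma measurable_on_line (x : Rn) : measurable_fun setT (fun t : R => psi (x + t *: h)).
Proof.
apply: (measurableT_comp mpsi).
apply: (@measurableT_comp _ _ _ _ _ _ _ _ (fun t : R => (x, t))
  (@measurable_line_rV R n h)).
exact: measurable_fun_pair.
Qed.

(** Whether the chord contains [a] or [b] is left open, since endpoints are negligible. *)
Lemma line_layer_itv (z : Rn * R) (a b : R) : 0 < z.2 ->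
  (forall t, z.2 < rho (z.1 + t *: h) -> a <= t <= b) ->
  (forall t, a < t < b -> z.2 < rho (z.1 + t *: h)) ->
  line_layer h psi rho z = (\int[leb]_(t in `[a, b]) (psi (z.1 + t *: h))%:E)%E.
Proof.
move=> z0 out inn.
have ml : measurable_fun setT (fun t : R => psi (z.1 + t *: h) *
    \1_`]0, rho (z.1 + t *: h)[ z.2).
  apply: (@measurableT_comp _ _ _ _ _ _ _ _ (fun t : R => (z, t))
    (measurable_layer_line h mpsi mrho)).
  exact: measurable_fun_pair.
transitivity (\int[leb]_(t in `[a, b]) (psi (z.1 + t *: h) *
    \1_`]0, rho (z.1 + t *: h)[ z.2)%:E)%E.
  rewrite [RHS]integral_mkcond; apply: eq_integral => t _.
  rewrite patchE; case: ifPn => // tab.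
  rewrite indicE memNset ?mulr0//= in_itv/= z0/= => /out tab'.
  by move: tab; rewrite notin_setE/= in_itv/= tab'.
apply: eq_integral_itv_bounded.
- exact: measurable_funS ml.
- exact: measurable_funS (measurable_on_line _).
- move=> t; rewrite in_itv/= => /inn zt.
  by rewrite indicE mem_set ?mulr1//= in_itv/= z0.
Qed.

Lemma line_layer_chord (z : Rn * R) : bounded_chords z ->
  line_layer h psi rho z =
  (\int[leb]_(t in `[chord_lo z, chord_hi z]) (psi (z.1 + t *: h))%:E)%E.
Proof.
move=> zg; have [[_ z0 _] _] := zg; apply: line_layer_itv => // t.
- exact: chord_hull.
- exact: chord_interior.
Qed.

(** At a positive level, two distinct real parameters would enclose a rational one, so the section
    is at most a point and its integral vanishes. *)
Lemma line_layer_nochord (z : Rn * R) : slab h z.1 -> ~ chords z ->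
  line_layer h psi rho z = 0%E.
Proof.
move=> zW nz; have [z0|z0] := leP z.2 0.
  apply: integral0_eq => t _; rewrite indicE memNset ?mulr0//= in_itv/=.
  by move=> /andP[]; rewrite ltNge z0.
have norat t : ~ chord_rat z t by move=> [q zq _]; apply: nz; split => //; exists q.
have uniq t1 t2 : z.2 < rho (z.1 + t1 *: h) -> z.2 < rho (z.1 + t2 *: h) -> t2 <= t1.
  move=> zt1 zt2; rewrite leNgt; apply/negP => t12.
  by have [t _ /norat] := chord_rat_between z0 t12 zt1 zt2.
have [[t0 zt0]|/forallNP nt] := pselect (exists t, z.2 < rho (z.1 + t *: h)).
  rewrite (line_layer_itv (a := t0) (b := t0))// ?set_itv1 ?integral_set1//.
    by move=> t zt; rewrite !uniq.
  by move=> t /andP[t1 t2]; have := lt_trans t1 t2; rewrite ltxx.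
rewrite (line_layer_itv (a := 0) (b := 0))// ?set_itv1 ?integral_set1//.
  by move=> t /nt.
by move=> t /andP[t1 t2]; have := lt_trans t1 t2; rewrite ltxx.
Qed.

End line_layer_chord.

Lemma le_line_layer1 (z : Rn * R) (t1 t2 : R) : 0 < z.2 -> t1 < t2 ->
  z.2 < rho (z.1 + t1 *: h) -> z.2 < rho (z.1 + t2 *: h) ->
  ((t2 - t1)%:E <= line_layer h (cst 1%R) rho z)%E.
Proof.
move=> z0 t12 z1 z2.
apply: (@le_trans _ _ (\int[leb]_t (\1_`[t1, t2] t)%:E)%E).
  by rewrite integral_indic//= setIT lebesgue_measure_itv/= lte_fin t12.
apply: ge0_le_integral => //.
- by apply/measurable_EFinP; exact: measurable_indic.
- apply/measurable_EFinP.
  have m1 : measurable_fun setT (cst 1 : Rn -> R) by [].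
  apply: (@measurableT_comp _ _ _ _ _ _ _ _ (fun t : R => (z, t))
    (measurable_layer_line h m1 mrho)).
  exact: measurable_fun_pair.
move=> t _; rewrite lee_fin /= mul1r indicE.
have [|//] := boolP (t \in _); rewrite inE/= in_itv/= => t12'.
by rewrite indicE mem_set//= in_itv/= z0/=; exact: line_between z1 z2.
Qed.

(** The length of a chord bounds the distance between any two of its points. *)
Lemma bounded_chords_finite (z : Rn * R) : chords z ->
  line_layer h (cst 1%R) rho z \is a fin_num -> bounded_chords z.
Proof.
move=> zc /fineK Lfin; split => //; have [_ z0 [q zq]] := zc.
set L := fine _ in Lfin.
exists (Num.truncn (`|ratr q : R| + `|L|)).+1 => //= _ [q' zq' <-].
suff : `|ratr q' : R| <= `|ratr q : R| + `|L| by move/le_trans; apply; exact/ltW/truncnS_gt.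
have dist : `|ratr q' - ratr q| <= L :> R.
  have [qq'|qq'|->] := ltgtP (ratr q : R) (ratr q').
  - rewrite gtr0_norm ?subr_gt0// -lee_fin Lfin; exact: le_line_layer1.
  - rewrite distrC gtr0_norm ?subr_gt0// -lee_fin Lfin; exact: le_line_layer1.
  - by rewrite subrr normr0 -lee_fin Lfin line_layer_ge0.
have := ler_normD (ratr q' - ratr q : R) (ratr q); rewrite subrK.
by have := ler_norm L; lra.
Qed.

End endpoints.

(** * Derivatives along lines *)

Section directional.
Context {R : realType} {n : nat}.
Notation Rn := 'rV[R]_n.
Notation leb := (@lebesgue_measure R).

Lemma is_derive_line (f : Rn -> R) (x v : Rn) (t : R) :
  derivable f (x + t *: v) v ->
  is_derive t (1 : R) (fun t : R => f (x + t *: v)) ('D_v f (x + t *: v)).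
Proof.
move=> df; set F := fun t : R => f (x + t *: v).
have E : (fun e : R => e^-1 *: ((F \o shift t) (e *: (1 : R)) - F t)) =
    (fun e : R => e^-1 *: ((f \o shift (x + t *: v)) (e *: v) - f (x + t *: v))).
  apply/funext => e /=; rewrite /F /=; congr (_ *: (f _ - _)).
  by rewrite [e *: 1]mulr1 scalerDl addrCA.
split; first by rewrite /derivable E.
by rewrite /derive E.
Qed.

Lemma lipschitz_line (f : Rn -> R) (v : Rn) (M : R) :
  (forall x, derivable f x v) -> (forall x, `|'D_v f x| <= M) ->
  forall x t, `|f (x + t *: v) - f x| <= M * `|t|.
Proof.
move=> df fM x t; pose F (s : R) := f (x + s *: v).
have dF s : is_derive s (1 : R) F ('D_v f (x + s *: v)) := is_derive_line (df _).
have cF : continuous F by move=> s; apply/differentiable_continuous/derivable1_diffP.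
have lip a b : a < b -> `|F b - F a| <= M * (b - a).
  move=> ab; have [|c _ ->] := @MVT R F (fun s => 'D_v f (x + s *: v)) a b ab (fun s _ => dF s).
    exact: continuous_subspaceT.
  by rewrite normrM (gtr0_norm (x := b - a)) ?subr_gt0// ler_wpM2r// subr_ge0 ltW.
have -> : f x = F 0 by rewrite /F scale0r addr0.
rewrite -/(F t); have [t0|t0|<-] := ltgtP 0 t.
- by rewrite (gtr0_norm t0); have := lip _ _ t0; rewrite subr0.
- by rewrite (ltr0_norm t0) distrC; have := lip _ _ t0; rewrite sub0r.
- by rewrite subrr !normr0 mulr0.
Qed.

(** [Cb_infty] only provides directional derivatives. Moving one coordinate at a time and using the
    mean value theorem on each move gives a Lipschitz bound. *)
Lemma bounded_derive_continuous (f : Rn -> R) :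
  (forall v x, derivable f x v) -> (forall v, exists M, forall x, `|'D_v f x| <= M) ->
  continuous f.
Proof.
move=> df bf.
have [M hM] := choice (fun i : 'I_n => bf (delta_mx ord0 i)).
have M0 i : 0 <= M i by exact: le_trans (normr_ge0 _) (hM i 0).
have step (v : Rn) (s : seq 'I_n) : forall x,
    `|f (x + \sum_(i <- s) v ord0 i *: delta_mx ord0 i) - f x| <=
    \sum_(i <- s) M i * `|v ord0 i|.
  elim: s => [x|i s IH x]; first by rewrite !big_nil addr0 subrr normr0.
  rewrite !big_cons addrA.
  set y := x + _ *: _; have := IH y.
  have := lipschitz_line (df (delta_mx ord0 i)) (hM i) x (v ord0 i).
  rewrite -/y => h1 h2; set u := y + _.
  have := ler_normD (f y - f x) (f u - f y).
  rewrite (_ : f y - f x + _ = f u - f x); last by ring.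
  by lra.
pose K := \sum_i M i.
have K0 : 0 <= K by apply: sumr_ge0.
have lip x y : `|f y - f x| <= K * `|y - x|.
  have := step (y - x) (index_enum _) x; rewrite -row_sum_delta [x + _]addrC subrK.
  move=> /le_trans; apply; rewrite mulr_suml; apply: ler_sum => i _.
  by rewrite ler_wpM2l// le_coord_norm_rV.
move=> x; apply/(@cvgrPdist_lt _ _ _ (nbhs x) (nbhs_filter x)) => e e0.
have K1 : 0 < K + 1 by lra.
apply/nbhs_ballP; exists (e / (K + 1)) => /=; first exact: divr_gt0.
move=> y; rewrite -ball_normE /= => xy; rewrite distrC.
apply: le_lt_trans (lip x y) _; rewrite distrC.
move: xy; rewrite ltr_pdivlMr// => xy; have := normr_ge0 (x - y); nra.
Qed.

Lemma Cb_infty_continuous (phi : Rn -> R) vs : Cb_infty phi ->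
  continuous (iter_dir_deriv vs phi).
Proof.
move=> [dphi bphi]; apply: bounded_derive_continuous => [v x|v].
  exact: dphi.
exact: bphi (v :: vs).
Qed.

Lemma integral_derive_line (phi : Rn -> R) (h x : Rn) (a b : R) :
  Cb_infty phi -> a <= b ->
  (\int[leb]_(t in `[a, b]) ('D_h phi (x + t *: h))%:E =
   (phi (x + b *: h) - phi (x + a *: h))%:E)%E.
Proof.
move=> Cphi; rewrite le_eqVlt => /predU1P[->|ab].
  by rewrite set_itv1 integral_set1 subrr.
pose F (t : R) := phi (x + t *: h).
have dF t : is_derive t (1 : R) F ('D_h phi (x + t *: h)).
  by apply: is_derive_line; exact: Cphi.1 [::] _ _.
have cF : continuous F by move=> s; apply/differentiable_continuous/derivable1_diffP.
have cl : continuous (fun t : R => x + t *: h).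
  by move=> t; apply: cvgD; [exact: cvg_cst|apply: cvgZr_tmp].
rewrite (@continuous_FTC2 _ (fun t => 'D_h phi (x + t *: h)) F)//.
- apply: continuous_subspaceT => t.
  apply: (@continuous_comp _ _ _ (fun t : R => x + t *: h) ('D_h phi)); first exact: cl.
  exact: (@Cb_infty_continuous phi [:: h] Cphi).
- split.
  + by move=> t _.
  + exact/cvg_at_right_filter/cF.
  + exact/cvg_at_left_filter/cF.
- by move=> t _; rewrite derive1E derive_val.
Qed.

End directional.

(** * The Skorohod derivative *)

Lemma finite_measureP d (T : measurableType d) (R : realType)
    (m : {measure set T -> \bar R}) : (m setT < +oo)%E ->
  exists m' : {finite_measure set T -> \bar R}, (m' : set T -> \bar R) = m.
Proof.
move=> moo; have finm : fin_num_fun m by exact: lty_fin_num_fun.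
have sfm : sigma_finite setT m.
  by apply: fin_num_fun_sigma_finite => //; rewrite measure0.
pose m' : {finite_measure set T -> \bar R} :=
  HB.pack_for (FiniteMeasure.type T R) (Measure.sort m)
  (isSFinite.Build _ _ _ (Measure.sort m) (sfinite_measure_sigma_finite sfm))
  (isSigmaFinite.Build _ _ _ (Measure.sort m) sfm)
  (isFinite.Build _ _ _ (Measure.sort m) finm).
by exists m'.
Qed.

Lemma bounded_integrable d (T : measurableType d) (R : realType)
    (m : {measure set T -> \bar R}) (D : set T) (f : T -> R) (M : R) :
  measurable D -> (m D < +oo)%E -> measurable_fun D f ->
  (forall x, `|f x| <= M) -> m.-integrable D (EFin \o f).
Proof.
move=> mD Doo mf fM; apply: measurable_bounded_integrable => //.
exists M; split; first exact: num_real.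
by move=> K MK x _; apply: le_trans (fM x) (ltW MK).
Qed.

Lemma bounded_integralB_opp d (T : measurableType d) (R : realType)
    (m : {measure set T -> \bar R}) (D : set T) (f g : T -> R) (M : R) :
  measurable D -> (m D < +oo)%E -> measurable_fun D f -> measurable_fun D g ->
  (forall x, `|f x| <= M) -> (forall x, `|g x| <= M) ->
  (\int[m]_(x in D) (f x - g x)%:E =
   - (\int[m]_(x in D) (g x)%:E - \int[m]_(x in D) (f x)%:E))%E.
Proof.
move=> mD Doo mf mg fM gM.
have intf := bounded_integrable mD Doo mf fM.
have intg := bounded_integrable mD Doo mg gM.
rewrite fin_num_oppeB; last exact: (integrable_fin_num mD intf).
rewrite addeC -(integralB_EFin mD intf intg).
by apply: eq_integral => x _; rewrite EFinB.
Qed.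

Section pushforward_restriction.
Context d1 d2 (T1 : measurableType d1) (T2 : measurableType d2) (R : realType).
Context (m : {measure set T1 -> \bar R}) (D : set T1) (mD : measurable D).
Context (B : T1 -> T2) (mB : measurable_fun setT B).
Hypothesis Doo : (m D < +oo)%E.

Lemma pushforward_mrestr : exists nu : {finite_measure set T2 -> \bar R},
  nu setT = m D /\
  forall (f : T2 -> R) (M : R), measurable_fun setT f -> (forall x, `|f x| <= M) ->
    (\int[nu]_x (f x)%:E = \int[m]_(x in D) (f (B x))%:E)%E.
Proof.
pose mr : {measure set T1 -> \bar R} := mrestr m mD.
pose nu0 : {measure set T2 -> \bar R} :=
  measure_function_pushforward__canonical__measure_function_Measure mr mB.
have nu0T : nu0 setT = m D.
  by rewrite /nu0/= /pushforward preimage_setT /mr/= /mrestr setTI.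
have [nu nuE] : exists nu : {finite_measure set T2 -> \bar R},
    (nu : set T2 -> \bar R) = nu0.
  by apply: finite_measureP; rewrite nu0T.
exists nu; rewrite nuE; split => // f M mf fM.
have mrT : (mr setT < +oo)%E by rewrite /mr/= /mrestr setTI.
have intB : mr.-integrable setT (EFin \o (f \o B)).
  apply: (bounded_integrable (M := M)) => //.
  - exact: measurableT_comp.
  - by move=> x; exact: fM.
transitivity (\int[mr]_x (f (B x))%:E)%E.
  rewrite [LHS](_ : _ = \int[pushforward mr B]_x (f x)%:E)%E//.
  rewrite (integral_pushforward mB)//.
  exact/measurable_EFinP.
have mC : measurable (~` D) by exact: measurableC.
rewrite (@negligible_integral _ _ _ mr setT (~` D))//; last first.
  by rewrite /mr/= /mrestr setICl measure0.
rewrite setTD setCK; apply: eq_measure_integral => A mA AD.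
by rewrite /mr/= /mrestr setIidl.
Qed.

End pushforward_restriction.

Section skorohod.
Context {R : realType} {n : nat}.
Notation Rn := 'rV[R]_n.
Notation leb := (@lebesgue_measure R).
Context (lam : {sigma_finite_measure set Rn -> \bar R}) (Hlam : is_lebesgue_Rn lam).
Context (mu : probability Rn R) (rho : Rn -> R).
Hypothesis mrho : measurable_fun setT rho.
Hypothesis rho_lc : log_concave rho.
Hypothesis muE : forall A, measurable A -> mu A = (\int[lam]_(x in A) (rho x)%:E)%E.
Context (h : Rn) (hh : dotRn h h = 1).

Notation G := (bounded_chords rho h).
Notation lo := (chord_lo rho h).
Notation hi := (chord_hi rho h).

Let rho0 x : 0 <= rho x := rho_lc.1 x.
Let mG : measurable G := measurable_bounded_chords mrho h.
Let W := slab h `*` [set: R].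
Let mW : measurable W.
Proof. by apply: measurableX => //; exact: measurable_slab. Qed.

Lemma ge0_integral_layer_mu (psi : Rn -> R) :
  measurable_fun setT psi -> (forall x, 0 <= psi x) ->
  (\int[mu]_x (psi x)%:E = \int[lam \x leb]_(z in W) line_layer h psi rho z)%E.
Proof.
move=> mpsi psi0; rewrite -(ge0_integral_line_layer Hlam hh mpsi mrho psi0 rho0).
rewrite (ge0_integral_density mrho rho0 muE); first exact: eq_integral.
- exact/measurable_EFinP.
- by move=> x; rewrite lee_fin.
Qed.

Lemma integrable_line_layer (psi : Rn -> R) (M : R) :
  measurable_fun setT psi -> (forall x, 0 <= psi x) -> (forall x, `|psi x| <= M) ->
  (lam \x leb)%E.-integrable W (line_layer h psi rho).
Proof.
move=> mpsi psi0 psiM; apply/integrableP; split.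
  exact: measurable_funS (measurable_line_layer h mpsi mrho psi0).
under eq_integral do rewrite gee0_abs ?line_layer_ge0//.
rewrite -ge0_integral_layer_mu//.
have /integrableP[_] : mu.-integrable setT (EFin \o psi).
  by apply: (bounded_integrable (M := M)) => //; rewrite -ge0_fin_numE ?fin_num_measure.
by under eq_integral do rewrite gee0_abs ?lee_fin//.
Qed.

(** Extended by zero off [G] to be measurable everywhere; only the measure restricted to [G] is
    pushed forward. *)
Definition endpoint (e : Rn * R -> R) (z : Rn * R) : Rn := z.1 + (e \_ G) z *: h.

Lemma measurable_endpoint (e : Rn * R -> R) :
  measurable_fun G e -> measurable_fun setT (endpoint e).
Proof.
move=> me; apply: (@measurableT_comp _ _ _ _ _ _ _ _
  (fun z : Rn * R => (z.1, (e \_ G) z)) (@measurable_line_rV R n h)).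
apply: measurable_fun_pair => //.
by apply/measurable_restrict => //; rewrite setTI.
Qed.

Lemma endpointE e z : G z -> endpoint e z = z.1 + e z *: h.
Proof. by move=> Gz; rewrite /endpoint patchE mem_set. Qed.

Lemma integral_derive_chords (phi : Rn -> R) : Cb_infty phi ->
  (\int[mu]_x ('D_h phi x)%:E =
   \int[lam \x leb]_(z in G) (phi (endpoint hi z) - phi (endpoint lo z))%:E)%E.
Proof.
move=> Cphi; have [M psiM] := Cphi.2 [:: h]; rewrite /= in psiM.
have mpsi : measurable_fun setT ('D_h phi).
  exact: (continuous_measurable_rV (@Cb_infty_continuous _ _ phi [:: h] Cphi)).
have mphi : measurable_fun setT phi.
  exact: (continuous_measurable_rV (@Cb_infty_continuous _ _ phi [::] Cphi)).
have M0 : 0 <= M by exact: le_trans (normr_ge0 _) (psiM 0).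
(* The layer formula needs nonnegative functions, so the bounded derivative is split as
   [psi1 - psi2]. *)
pose psi1 (x : Rn) := 'D_h phi x + M.
pose psi2 (x : Rn) := M.
have mpsi1 : measurable_fun setT psi1 by exact: measurable_funD.
have mpsi2 : measurable_fun setT psi2 by exact: measurable_cst.
have psi1_ge0 x : 0 <= psi1 x.
  by have := psiM x; rewrite ler_norml /psi1 => /andP[? _]; lra.
have psi2_ge0 x : 0 <= psi2 x by exact: M0.
have psi1_le x : `|psi1 x| <= 2 * M.
  by rewrite ger0_norm//; have := psiM x; rewrite ler_norml /psi1 => /andP[_ ?]; lra.
have psi2_le x : `|psi2 x| <= M by rewrite ger0_norm.
have muT : (mu setT < +oo)%E by rewrite probability_setT ltry.
have i1 : mu.-integrable setT (EFin \o psi1) by exact: bounded_integrable psi1_le.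
have i2 : mu.-integrable setT (EFin \o psi2) by exact: bounded_integrable psi2_le.
transitivity (\int[mu]_x (psi1 x)%:E - \int[mu]_x (psi2 x)%:E)%E.
  rewrite -integralB_EFin//; apply: eq_integral => x _.
  by rewrite -EFinB /psi1 /psi2 addrK.
rewrite !ge0_integral_layer_mu// -integralB//; last 2 first.
- exact: integrable_line_layer psi1_le.
- exact: integrable_line_layer psi2_le.
have [mlo mhi] : measurable_fun setT (endpoint lo) /\ measurable_fun setT (endpoint hi).
  split; apply: measurable_endpoint; first exact: measurable_chord_lo.
  exact: measurable_chord_hi.
pose D z := (phi (endpoint hi z) - phi (endpoint lo z))%:E.
have mD : measurable_fun setT D.
  by apply/measurable_EFinP; apply: measurable_funB; exact: measurableT_comp.
have GW : W `&` G = G.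
  by apply/setIidPr => z [[zW _ _] _]; split.
rewrite -[X in _ = integral _ X _]GW [RHS]integral_mkcondr.
have m1 : measurable_fun setT (cst 1 : Rn -> R) by [].
(* Integrable chord lengths are finite almost everywhere, so almost every chord is bounded. *)
have int1 : (lam \x leb)%E.-integrable W (line_layer h (cst 1%R) rho).
  by apply: (integrable_line_layer (M := 1)) => // x; rewrite normr1.
apply: ae_eq_integral => //.
- apply: emeasurable_funB.
    exact: measurable_funS (measurable_line_layer h mpsi1 mrho psi1_ge0).
  exact: measurable_funS (measurable_line_layer h mpsi2 mrho psi2_ge0).
- by apply: (measurable_restrict D mG mW).1; apply: measurable_funTS.
move/integrable_ae : int1 => /(_ mW); apply: filterS => z zfin zW.
have {}zfin := zfin zW; have [zW1 _] := zW.
rewrite patchE; case: ifPn => [/set_mem Gz|/negP nGz].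
  rewrite !(line_layer_chord mrho rho_lc)// /D !endpointE//.
  rewrite -(integral_derive_line h z.1 Cphi (chord_lo_le_hi Gz)).
  have lebI : (leb `[lo z, hi z] < +oo)%E.
    by rewrite /= lebesgue_measure_itv; case: ifP => _; rewrite -?EFinB ltry.
  have j1 : leb.-integrable `[lo z, hi z] (EFin \o (fun t => psi1 (z.1 + t *: h))).
    apply: (bounded_integrable (M := 2 * M)) => //.
    exact: measurable_funS (measurable_on_line h mpsi1 _).
  have j2 : leb.-integrable `[lo z, hi z] (EFin \o (fun t => psi2 (z.1 + t *: h))).
    exact: (bounded_integrable (M := M)).
  rewrite -integralB_EFin//; apply: eq_integral => t _.
  by rewrite -EFinB /psi1 /psi2 addrK.
(* Off [G], a finite length excludes any chord, and both layers vanish. *)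
rewrite !(line_layer_nochord mrho rho_lc)// ?sube0//.
all: by move=> /(bounded_chords_finite mrho rho_lc) /(_ zfin) Gz; apply: nGz; exact: mem_set.
Qed.

Lemma skorohod_deriv_TV_le_chords (c : R) :
  ((lam \x leb) (chords rho h) <= c%:E)%E -> skorohod_deriv_TV_le mu h (2 * c).
Proof.
move=> hc.
have Gc : ((lam \x leb) G <= c%:E)%E.
  apply: le_trans hc; apply: le_measure; rewrite ?inE.
  - exact: mG.
  - exact: measurable_chords.
  - by move=> z [].
have Goo : ((lam \x leb) G < +oo)%E by exact: le_lt_trans Gc (ltry _).
have mlo := measurable_endpoint (measurable_chord_lo (h := h) mrho).
have mhi := measurable_endpoint (measurable_chord_hi (h := h) mrho).
have [nu1 [nu1T int1]] := @pushforward_mrestr _ _ _ _ R (lam \x leb)%E G mG _ mlo Goo.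
have [nu2 [nu2T int2]] := @pushforward_mrestr _ _ _ _ R (lam \x leb)%E G mG _ mhi Goo.
(* Lower endpoints give the positive part and upper ones the negative part, matching the minus sign
   in the definition; each has mass at most [c]. *)
exists nu1, nu2; split; last first.
  by rewrite nu1T nu2T (_ : 2 * c = c + c) ?EFinD ?leeD//; ring.
move=> phi Cphi; have [M phiM] := Cphi.2 [::]; rewrite /= in phiM.
have mphi : measurable_fun setT phi.
  exact: (continuous_measurable_rV (@Cb_infty_continuous _ _ phi [::] Cphi)).
rewrite integral_derive_chords// (int1 _ M)// (int2 _ M)//.
apply: (bounded_integralB_opp (M := M)) => //.
- by apply: measurable_funTS; exact: measurableT_comp.
- by apply: measurable_funTS; exact: measurableT_comp.
Qed.

End skorohod.

Theorem theorem3p1 (R : realType) (n : nat) :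
  exists C : R,
  forall (lam : {measure set 'rV[R]_n -> \bar R}), is_lebesgue_Rn lam ->
  forall (mu : probability 'rV[R]_n R) (rho : 'rV[R]_n -> R),
    log_concave_density lam mu rho ->
    isotropic_with_const mu 1 ->
  forall h : 'rV[R]_n, dotRn h h = 1 ->
    skorohod_deriv_TV_le mu h C.
Proof.
exists (2 * @chords_bound R n) => lam Hlam mu rho [mrho [[V [Vconv rhoV]] muE]] mu_iso h hh.
have [lam' lamE] := sigma_finite_measureP (lebesgue_rV_sigma_finite Hlam).
have Hlam' : is_lebesgue_Rn lam'.
  by move=> a b ab; have := Hlam a b ab; rewrite -lamE.
have muE' A : measurable A -> mu A = (\int[lam']_(x in A) (rho x)%:E)%E.
  by move=> mA; rewrite muE// lamE.
have rho_lc := log_concave_expeR Vconv rhoV.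
apply: (skorohod_deriv_TV_le_chords Hlam' mrho rho_lc muE' hh).
exact: (measure_chords_le Hlam' mrho rho_lc muE' mu_iso hh).
Qed.
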